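(* Let $m \ge 9$ and $n \ge m^2 - m + 1$ be integers, and let $T_n$ be any tree on $n$ vertices. Then $R(T_n, F_m) = 2n - 1$.
   Context: All graphs are finite and simple. For graphs $H$ and $K$, the Ramsey number $R(H,K)$ is the smallest positive integer $N$ such that for every graph $G$ on $N$ vertices, either $G$ contains $H$ as a subgraph or the complement $\overline{G}$ contains $K$ as a subgraph. The fan $F_m$ is the graph on $2m+1$ vertices consisting of $m$ triangles sharing one common vertex (equivalently, a vertex joined to every vertex of a matching with $m$ edges). *)

(* Defs.v *)
From mathcomp Require Import all_boot.
Set Implicit Arguments. Unset Strict Implicit. Unset Printing Implicit Defensive.

Definition simple_graph (V : finType) (e : rel V) : Prop :=
  symmetric e /\ irreflexive e.

Definition compl_graph (V : finType) (e : rel V) : rel V :=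
  fun x y => (x != y) && ~~ e x y.

Definition contains_subgraph (V W : finType) (G : rel V) (H : rel W) : Prop :=
  exists f : W -> V, injective f /\ forall x y, H x y -> G (f x) (f y).

Definition ramsey_prop (W1 W2 : finType) (H : rel W1) (K : rel W2) (N : nat)
  : Prop :=
  forall G : rel 'I_N, simple_graph G ->
    contains_subgraph G H \/ contains_subgraph (compl_graph G) K.

Definition is_ramsey_number (W1 W2 : finType) (H : rel W1) (K : rel W2)
  (N : nat) : Prop :=
  0 < N /\ ramsey_prop H K N /\ (forall M, 0 < M -> M < N -> ~ ramsey_prop H K M).

Definition connected_graph (V : finType) (e : rel V) : Prop :=
  forall x y : V, connect e x y.

Definition acyclic_graph (V : finType) (e : rel V) : Prop :=
  forall p : seq V, uniq p -> 3 <= size p -> ~~ cycle e p.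

Definition is_tree (V : finType) (e : rel V) : Prop :=
  simple_graph e /\ connected_graph e /\ acyclic_graph e.

(* The fan F_m on vertices 0..2m: centre 0 adjacent to all others,
   plus the matching {1,2},{3,4},...,{2m-1,2m}. *)
Definition fan (m : nat) : rel 'I_(2 * m + 1) :=
  fun i j =>
    (i != j) &&
    [|| (val i == 0), (val j == 0) | ((val i).-1./2 == (val j).-1./2)].
Arguments fan m : clear implicits.

(* Main.v *)
Require Import Defs.
From mathcomp Require Import all_boot zify.
Set Implicit Arguments. Unset Strict Implicit. Unset Printing Implicit Defensive.

(* The lower bound comes from two disjoint red cliques on at most [n - 1] vertices
   each. For the upper bound, call the edges of [G] red and the other pairs blue,
   and suppose that there is neither a red [T] nor a blue fan. Some vertex has [n]
   blue neighbours, since otherwise [T] embeds greedily. Blue matchings among them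
   have fewer than [m] edges, so by Gallai's exchange argument the deletion of
   [a < m] of them leaves a "core" [Q :|: Z] of [n - a] vertices in which [Q] is
   red to everything and [#|Z| <= 3 (m - 1 - a)]. A part of [T] with [n - a]
   vertices embeds into the core, [Z] receiving an independent set; hence there
   are few red edges leaving the core, some [x] in [Q] has [n] blue neighbours
   outside it, and these contain a second core, of [n - b] vertices. The pairs
   between the cores are mostly blue, so a vertex outside both with many blue
   neighbours in each core would be the centre of a blue fan. Thus each of the
   [a + b - 1] remaining vertices is red to most of one core, and either [a] of
   them complete the first core or [b] of them complete the second one to [n]
   vertices that span [T].

   What "few", "mostly" and "complete" mean depends on [T]: it has a vertex with
   [m - 1] leaf neighbours, or [m - 1] leaves of which no vertex sees more than
   [m / 2], or neither. In the last case [T] has few leaves, hence [m - 1] vertices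
   of degree at most [2] with disjoint closed neighbourhoods, and an edge whose
   removal leaves two parts with at least [m - 1] vertices each. *)

(** * Matchings *)

Section Matchings.
Variable V : finType.
Implicit Types (e : rel V) (f : {ffun V -> V}) (A D S Z : {set V}).

(* A matching is encoded by the involution that swaps the two ends of each of its
   edges and fixes the other vertices. *)
Definition matching e f :=
  [forall x, (f (f x) == x) && ((f x == x) || e x (f x))].

Definition covered f := [set x | f x != x].

Definition rel_on A e : rel V := fun x y => [&& x \in A, y \in A & e x y].

Lemma matchingK e f : matching e f -> involutive f.
Proof. by move=> /forallP H x; case/andP: (H x) => /eqP. Qed.

Lemma matching_edge e f x : matching e f -> f x != x -> e x (f x).
Proof. by move=> /forallP H /negPf Hx; case/andP: (H x) => _; rewrite Hx. Qed.

Lemma matchingP e f :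
  involutive f -> (forall x, f x != x -> e x (f x)) -> matching e f.
Proof.
move=> fK He; apply/forallP=> x; rewrite fK eqxx /=.
by case: eqP => //= /eqP /He.
Qed.

Lemma matching_sub e e' f :
  (forall x y, e x y -> e' x y) -> matching e f -> matching e' f.
Proof.
move=> sub Hf; apply: matchingP; first exact: matchingK Hf.
by move=> x /(matching_edge Hf) /sub.
Qed.

(** Lists one end of each edge, so that a matching can be counted and laid out as a sequence of
    pairs. *)
Lemma matching_pairs e f : matching e f ->
  exists s, uniq (s ++ map f s) /\ covered f =i s ++ map f s.
Proof.
move=> Hf; have fK := matchingK Hf; have fI := can_inj fK.
(* The end of smaller rank represents its edge; a fixed vertex ties with itself and drops out. *)
pose s := [seq x <- enum V | enum_rank x < enum_rank (f x)].
have mems x : (x \in s) = (enum_rank x < enum_rank (f x)).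
  by rewrite mem_filter mem_enum andbT.
exists s; split.
  rewrite cat_uniq filter_uniq ?enum_uniq //= (map_inj_uniq fI) filter_uniq ?enum_uniq // andbT.
  apply/hasPn=> _ /mapP[x xs ->]; rewrite mems fK -leqNgt.
  by rewrite mems in xs; apply: ltnW.
move=> x; rewrite inE mem_cat mems.
have -> : (x \in map f s) = (f x \in s) by rewrite -{1}(fK x) (mem_map fI).
rewrite mems fK.
case: (ltngtP (enum_rank x) (enum_rank (f x))) => [H|H|/ord_inj/enum_rank_inj <-].
- by apply/negP=> /eqP E; rewrite E ltnn in H.
- by apply/negP=> /eqP E; rewrite E ltnn in H.
- by rewrite eqxx.
Qed.

Lemma covered_even e f : matching e f -> ~~ odd #|covered f|.
Proof.
move=> Hf; have [s [us cs]] := matching_pairs Hf.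
by rewrite (eq_card cs) (card_uniqP us) size_cat size_map addnn odd_double.
Qed.

(** * Augmentation and exchange in maximum matchings *)

Section Exchange.
Variable e : rel V.
Hypotheses (e_sym : symmetric e) (e_irr : irreflexive e).

Lemma matching_augment f x y : matching e f -> e x y -> f x = x -> f y = y ->
  exists2 f', matching e f' & covered f' = x |: (y |: covered f).
Proof.
move=> Hf exy fx fy; have fK := matchingK Hf.
have nxy : x != y by apply: contraTneq exy => ->; rewrite e_irr.
pose f' := [ffun v => if v == x then y else if v == y then x else f v].
have f'x : f' x = y by rewrite ffunE eqxx.
have f'y : f' y = x by rewrite ffunE eqxx eq_sym (negPf nxy).
have f'o v : v != x -> v != y -> f' v = f v.
  by rewrite ffunE => /negPf -> /negPf ->.
exists f'.
  apply: matchingP => v; last first.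
    have [->|vx] := eqVneq v x; first by rewrite f'x.
    have [->|vy] := eqVneq v y; first by rewrite f'y e_sym.
    by rewrite f'o // => /(matching_edge Hf).
  have [->|vx] := eqVneq v x; first by rewrite f'x f'y.
  have [->|vy] := eqVneq v y; first by rewrite f'y f'x.
  have fvx : f v != x by apply: contra vx => /eqP E; rewrite -(fK v) E fx.
  have fvy : f v != y by apply: contra vy => /eqP E; rewrite -(fK v) E fy.
  by rewrite !f'o.
apply/setP=> v; rewrite !inE; have [->|vx] := eqVneq v x.
  by rewrite f'x eq_sym nxy.
have [->|vy] := eqVneq v y; first by rewrite f'y nxy.
by rewrite f'o.
Qed.

(** An alternating path of length two: the edge at [y] is traded for [xy], so the size is kept and
    [f y] is freed in place of [x]. The extremal arguments below use only this move and
    augmentation. *)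
Lemma matching_exchange f x y : matching e f -> e x y -> f x = x -> f y != y ->
  exists f', [/\ matching e f', covered f' = x |: covered f :\ f y,
    f' x = y, f' y = x & forall v, v != x -> v != y -> v != f y -> f' v = f v].
Proof.
move=> Hf exy fx fy; have fK := matchingK Hf.
have nxy : x != y by apply: contraTneq exy => ->; rewrite e_irr.
have nxz : x != f y by apply: contra nxy => /eqP E; rewrite -fx E fK.
pose f' := [ffun v => if v == x then y else if v == y then x
  else if v == f y then v else f v].
have f'x : f' x = y by rewrite ffunE eqxx.
have f'y : f' y = x by rewrite ffunE eqxx eq_sym (negPf nxy).
have f'z : f' (f y) = f y.
  by rewrite ffunE eqxx (negPf fy) eq_sym (negPf nxz).
have f'o v : v != x -> v != y -> v != f y -> f' v = f v.
  by rewrite ffunE => /negPf -> /negPf -> /negPf ->.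
exists f'; split=> //.
  apply: matchingP => v; last first.
    have [->|vx] := eqVneq v x; first by rewrite f'x.
    have [->|vy] := eqVneq v y; first by rewrite f'y e_sym.
    have [->|vz] := eqVneq v (f y); first by rewrite f'z eqxx.
    by rewrite f'o // => /(matching_edge Hf).
  have [->|vx] := eqVneq v x; first by rewrite f'x f'y.
  have [->|vy] := eqVneq v y; first by rewrite f'y f'x.
  have [->|vz] := eqVneq v (f y); first by rewrite !f'z.
  have fvx : f v != x by apply: contra vx => /eqP E; rewrite -(fK v) E fx.
  have fvy : f v != y by apply: contra vz => /eqP <-; rewrite fK.
  have fvz : f v != f y by rewrite (inj_eq (can_inj fK)).
  by rewrite !f'o.
apply/setP=> v; rewrite !inE; have [->|vx] := eqVneq v x.
  by rewrite f'x eq_sym nxy.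
have [->|vz] := eqVneq v (f y); first by rewrite f'z eqxx.
have [->|vy] := eqVneq v y; first by rewrite f'y nxy fy.
by rewrite f'o.
Qed.

Lemma maximum_matching_maximal c f x y :
  (forall h, matching e h -> #|covered h| <= c) ->
  matching e f -> #|covered f| = c -> e x y -> f x = x -> f y != y.
Proof.
move=> maxc Hf cf exy fx; apply/negP=> /eqP fy.
have [h Hh Ch] := matching_augment Hf exy fx fy.
have nxy : (x == y) = false by apply: contraTF exy => /eqP ->; rewrite e_irr.
by have := maxc _ Hh; rewrite Ch !cardsU1 cf !inE fx fy nxy !eqxx /= => /ltnW; rewrite ltnn.
Qed.

(* Among the maximum matchings [h] missing [z] take one closest to [f]; some
   [x <> z] is covered by [f] but not by [h], and switching [h] to use the edge
   of [f] at [x] brings it closer to [f]. *)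
Lemma maximum_matching_common_neighbour c f g z o o' :
  (forall h, matching e h -> #|covered h| <= c) ->
  matching e f -> #|covered f| = c -> matching e g -> #|covered g| = c ->
  g z = z -> e o z -> e o' z -> f o = o -> f o' = o' -> o = o'.
Proof.
move=> maxc Hf cf Hg cg gz oz o'z fo fo'; apply/eqP/negPn/negP=> noo'.
pose P h := [&& matching e h, #|covered h| == c & h z == z].
have Pg : P g by rewrite /P Hg cg gz !eqxx.
have [h [/and3P[Hh /eqP ch /eqP hz] hmax]] : exists h : {ffun V -> V},
    P h /\ forall h', P h' -> #|[set v | h' v == f v]| <= #|[set v | h v == f v]|.
  by case: (@arg_maxnP _ g P (fun h => #|[set v | h v == f v]|) Pg) => h; exists h.
have noaug u v := maximum_matching_maximal maxc Hh ch (x := u) (y := v).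
have ho u : e u z -> h u != u by rewrite e_sym => /noaug; apply.
have sub : o |: [set o'] \subset covered h :\: covered f.
  apply/subsetP=> v; rewrite !inE => /orP[] /eqP ->.
    by rewrite fo eqxx ho.
  by rewrite fo' eqxx ho.
(* [h] covers [o] and [o'] while [f] does not; as the two matchings have equal size, [f] covers two
   vertices missed by [h], one of them different from [z]. *)
have : 2 <= #|covered f :\: covered h|.
  have E : #|covered f :\: covered h| = #|covered h :\: covered f|.
    have := cardsID (covered f) (covered h); have := cardsID (covered h) (covered f).
    by rewrite setIC cf ch => <- /addnI ->.
  by rewrite E; have := subset_leq_card sub; rewrite cardsU1 cards1 inE noo'.
rewrite (cardsD1 z) => H.
have {H} : 0 < #|(covered f :\: covered h) :\ z| by have := leq_trans H (leq_add (leq_b1 _) (leqnn _)).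
case/card_gt0P=> x; rewrite !inE negbK => /and3P[xz /eqP hx fx].
have fK := matchingK Hf; have hK := matchingK Hh.
have exy := matching_edge Hf fx.
have hy := noaug _ _ exy hx.
have [h' [Hh' Ch' h'x h'y h'o]] := matching_exchange Hh exy hx hy.
have nzy : z != f x by apply: contraNneq hy => <-; rewrite hz.
have nzhy : z != h (f x) by apply: contraNneq nzy => E; rewrite -(hK (f x)) -E hz.
have h'z : h' z = z by rewrite h'o // eq_sym.
have nxz1 : x != h (f x) by apply: contraNneq fx => E; rewrite -(hK (f x)) -E hx.
have ch' : #|covered h'| = c.
  by rewrite Ch' cardsU1 !inE hx eqxx andbF -ch [in RHS](cardsD1 (h (f x))) inE hK eq_sym hy.
have Ph' : P h' by rewrite /P Hh' ch' h'z !eqxx.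
have := hmax _ Ph'; rewrite leqNgt; case/negP.
apply: proper_card; apply/properP; split; last first.
  by exists x; rewrite inE ?h'x // hx eq_sym.
apply/subsetP=> v; rewrite !inE => /eqP hv.
have [->|vx] := eqVneq v x; first by rewrite h'x.
have [->|vy] := eqVneq v (f x); first by rewrite h'y fK.
have vz : v != h (f x).
  by apply: contraNneq vx => E; apply/eqP/(can_inj fK); rewrite -hv E hK.
by rewrite h'o // hv.
Qed.

Lemma matching_id : matching e [ffun x => x].
Proof. by apply: matchingP => x; rewrite !ffunE ?eqxx. Qed.
End Exchange.

(** * Gallai decomposition and the bipartite bound *)

Section Decomposition.
Variable e : rel V.
Hypotheses (e_sym : symmetric e) (e_irr : irreflexive e).

Lemma rel_on_sym A : symmetric (rel_on A e).
Proof. by move=> x y; rewrite /rel_on e_sym andbCA. Qed.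

Lemma rel_on_irr A : irreflexive (rel_on A e).
Proof. by move=> x; rewrite /rel_on e_irr !andbF. Qed.

(** [f] covers [2k] vertices. Each uncovered non-isolated [x] picks a neighbour [phi x]; these are
    distinct by [maximum_matching_common_neighbour], and no edge of [f] contains two of them, so
    there are at most [k] such [x]. *)
Lemma card_non_isolated k A f :
  (forall h, matching (rel_on A e) h -> #|covered h| <= k.*2) ->
  matching (rel_on A e) f -> #|covered f| = k.*2 ->
  (forall s, s \in A -> exists g,
    [/\ matching (rel_on A e) g, #|covered g| = k.*2 & g s = s]) ->
  #|[set x | [exists y, rel_on A e x y]]| <= 3 * k.
Proof.
move=> maxk Hf cf ines; set Z := [set x | _]; set eA := rel_on A e in maxk Hf ines Z *.
have eAs : symmetric eA := @rel_on_sym A; have eAi : irreflexive eA := @rel_on_irr A.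
have fK := matchingK Hf.
pose phi x := odflt x [pick y | eA x y].
have phiE x : x \in Z -> eA x (phi x).
  rewrite inE /phi => /existsP[y exy].
  by case: pickP => [//|/(_ y)]; rewrite exy.
pose U := Z :\: covered f.
have UP x : x \in U -> [/\ eA x (phi x), f x = x & f (phi x) != phi x].
  rewrite inE => /andP[fx /phiE exy]; rewrite inE negbK in fx; move/eqP in fx.
  by split=> //; apply: (maximum_matching_maximal eAs eAi maxk Hf cf exy).
have phiI : {in U &, injective phi}.
  move=> x y /UP[ex fx _] /UP[ey fy _] E.
  have /and3P[_ pA _] := ex.
  have [g [Hg cg gp]] := ines _ pA.
  by apply: (maximum_matching_common_neighbour eAs eAi maxk Hf cf Hg cg gp ex _ fx fy); rewrite E.
(* Otherwise [x], [phi x], [phi y], [y] is an augmenting path: after an exchange at [x] both [y] and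
   [phi y] are free, against maximality. *)
have phiD x y : x \in U -> y \in U -> phi x != f (phi y).
  move=> xU yU; have [ex fx px] := UP _ xU; have [ey fy py] := UP _ yU.
  apply/negP=> /eqP E.
  have nxy : y != x by apply: contraNneq py => Exy; rewrite -E Exy.
  have [h [Hh Ch hx hpx ho]] := matching_exchange eAs eAi Hf ex fx px.
  have fpx : f (phi x) = phi y by rewrite E fK.
  have ch : #|covered h| = k.*2.
    rewrite Ch cardsU1 !inE fx eqxx andbF -cf [in RHS](cardsD1 (f (phi x))) inE fK.
    by rewrite eq_sym px.
  have hy : h y = y.
    rewrite ho // ?fpx; first by apply: contraNneq px => <-; rewrite fy.
    by apply: contraNneq py => <-; rewrite fy.
  have := maximum_matching_maximal eAs eAi maxk Hh ch ey hy.
  have : phi y \notin covered h.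
    rewrite Ch !inE fpx eqxx /= orbF.
    by apply: contraNneq py => ->; rewrite fx.
  by rewrite inE negbK => ->.
have cU : #|U| <= k.
  have D : [disjoint phi @: U & f @: (phi @: U)].
    apply/pred0P=> v /=; apply/negP=> /andP[/imsetP[x xU ->] /imsetP[_ /imsetP[y yU ->]]].
    by apply/eqP/phiD.
  have sub : phi @: U :|: f @: (phi @: U) \subset covered f.
    apply/subsetP=> _ /setUP[/imsetP[x /UP[_ _ fx] ->]|/imsetP[_ /imsetP[x /UP[_ _ fx] ->] ->]].
      by rewrite inE.
    by rewrite inE fK eq_sym.
  have := subset_leq_card sub.
  rewrite cardsU (disjoint_setI0 D) cards0 subn0 (card_imset _ (can_inj fK)) card_in_imset //.
  by rewrite addnn cf leq_double.
have -> : #|Z| = #|Z :&: covered f| + #|U| by rewrite cardsID.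
have := subset_leq_card (subsetIr Z (covered f)); rewrite cf => H.
by rewrite mulSn addnC mul2n leq_add.
Qed.

(* As long as some vertex is covered by every maximum matching, remove it; when
   no such vertex is left, [card_non_isolated] applies. *)
Lemma matching_decomposition k A :
  (forall f, matching (rel_on A e) f -> #|covered f| <= k.*2) ->
  exists S Z, [/\ S \subset A, Z \subset A :\: S, 3 * #|S| + #|Z| <= 3 * k &
    forall x y, x \in A :\: S -> y \in A :\: S -> e x y -> x \in Z].
Proof.
elim: k A => [|k IH] A maxk.
  exists set0, set0; rewrite !sub0set !cards0; split=> // x y.
  rewrite !setD0 => xA yA exy.
  have exy' : rel_on A e x y by apply/and3P.
  have Hid := matching_id (rel_on A e).
  have cid : #|covered [ffun x : V => x]| = 0.
    by apply/eqP; rewrite cards_eq0 -subset0; apply/subsetP=> v; rewrite inE ffunE eqxx.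
  have := maximum_matching_maximal (@rel_on_sym A) (@rel_on_irr A) maxk Hid cid exy'.
  by rewrite !ffunE eqxx => /(_ erefl).
have [small|] := boolP [forall f, matching (rel_on A e) f ==> (#|covered f| <= k.*2)].
  have [f Hf|S [Z [SA ZA cSZ H]]] := IH A; first by have /forallP/(_ f)/implyP := small; apply.
  by exists S, Z; split=> //; rewrite (leq_trans cSZ) // leq_mul2l leqnSn.
rewrite negb_forall => /existsP[f]; rewrite negb_imply -ltnNge => /andP[Hf cf].
(* Covered sets have even size, so exceeding [2k] means reaching exactly [2(k + 1)]. *)
have max2k (g : {ffun V -> V}) (B : {set V}) : B \subset A -> matching (rel_on B e) g -> k.*2 < #|covered g| -> matching (rel_on A e) g /\ #|covered g| = k.+1.*2.
  move=> BA Hg cg; have Hg' : matching (rel_on A e) g.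
    by apply: matching_sub Hg => x y /and3P[xB yB exy]; rewrite /rel_on exy !(subsetP BA).
  split=> //; apply/eqP; rewrite eqn_leq maxk //= doubleS ltn_neqAle cg andbT.
  by apply: contra (covered_even Hg) => /eqP <-; rewrite /= odd_double.
have {Hf cf} [Hf cf] := max2k f A (subxx A) Hf cf.
have [/exists_inP[s sA /forallP small]|] :=
    boolP [exists s in A, [forall g, matching (rel_on (A :\ s) e) g ==> (#|covered g| <= k.*2)]].
  have [g Hg|S [Z [SA ZA cSZ H]]] := IH (A :\ s); first by have /implyP := small g; apply.
  have sS : s \notin S by apply: contraTN SA => sS; apply/subsetPn; exists s; rewrite // !inE eqxx.
  exists (s |: S), Z; rewrite -setDDl; split=> //.
    by rewrite subUset sub1set sA (subset_trans SA) // subD1set.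
  by rewrite cardsU1 sS mulnDr -addnA mulnSr addnC leq_add2r.
rewrite negb_exists_in => /forall_inP ines.
exists set0, [set x | [exists y, rel_on A e x y]]; rewrite sub0set cards0 muln0 setD0; split=> //.
- by apply/subsetP=> x; rewrite inE => /existsP[y /and3P[]].
- apply: (card_non_isolated maxk Hf cf) => s sA; have := ines s sA.
  rewrite negb_forall => /existsP[g]; rewrite negb_imply -ltnNge => /andP[Hg cg].
  have [Hg' cg'] := max2k g _ (subD1set A s) Hg cg.
  exists g; split=> //; apply/eqP/negPn/negP=> gs.
  by have := matching_edge Hg gs; rewrite /rel_on !inE eqxx.
- by move=> x y xA yA exy; rewrite inE; apply/existsP; exists y; apply/and3P.
Qed.

(* If [f] is a maximum matching between [D] and [D'], then each edge of [f]
   has an endpoint with no neighbour among the uncovered vertices. *)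
Lemma bipartite_matching D D' m al be :
  [disjoint D & D'] ->
  (forall f, matching e f -> (forall x, f x != x -> (x \in D :|: D')) -> #|covered f| < m.*2) ->
  m <= #|D| -> m <= #|D'| ->
  (forall x, x \in D -> #|[set y in D' | ~~ e x y]| <= al) ->
  (forall y, y \in D' -> #|[set x in D | ~~ e x y]| <= be) ->
  #|D| + #|D'| < al + be + m.
Proof.
move=> dD nomatch mD mD' Hal Hbe.
have DD' x : x \in D -> x \in D' -> False.
  by move=> xD xD'; have /pred0P/(_ x) := dD; rewrite /= xD xD'.
pose e' : rel V := fun x y => e x y && ((x \in D) && (y \in D') || (x \in D') && (y \in D)).
have es' : symmetric e' by move=> x y; rewrite /e' e_sym andbC orbC (andbC (x \in D')) (andbC (x \in D)) andbC.
have ei' : irreflexive e' by move=> x; rewrite /e' e_irr.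
have [f [Hf maxf]] : exists f : {ffun V -> V}, matching e' f /\
    forall h, matching e' h -> #|covered h| <= #|covered f|.
  by case: (@arg_maxnP _ _ (matching e') (fun h => #|covered h|) (matching_id e')) => f; exists f.
have fK := matchingK Hf.
have fD x : f x != x -> x \in D -> f x \in D'.
  by move=> /(matching_edge Hf)/andP[_ /orP[]/andP[] //] xD' _ xD; case: (DD' x).
have fD' x : f x != x -> x \in D' -> f x \in D.
  by move=> /(matching_edge Hf)/andP[_ /orP[]/andP[] //] xD' _ xD; case: (DD' x).
have covf : #|covered f| < m.*2.
  apply: nomatch => [|x /(matching_edge Hf)/andP[_ /orP[]/andP[xD _]]]; last 2 first.
  - by rewrite inE xD.
  - by rewrite inE xD orbT.
  by apply: matching_sub Hf => x y /andP[].
pose I := D :&: covered f.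
have fI : D' :&: covered f = f @: I.
  apply/setP=> y; apply/idP/imsetP=> [|[x]].
    rewrite !inE => /andP[yD' fy]; exists (f y); rewrite ?fK // !inE fK eq_sym fy andbT.
    exact: fD'.
  by rewrite !inE => /andP[xD fx] ->; rewrite fK eq_sym fx andbT; apply: fD.
have cov2 : #|covered f| = #|I|.*2.
  have -> : covered f = I :|: f @: I.
    rewrite -fI -setIUl; apply/esym/setIidPr/subsetP=> x; rewrite !inE.
    by move/(matching_edge Hf)/andP=> [_ /orP[]/andP[-> _] //]; rewrite orbT.
  rewrite cardsU disjoint_setI0 ?cards0 ?subn0 ?(card_imset _ (can_inj fK)) ?addnn //.
  rewrite -fI; apply/pred0P=> x; apply/negP=> /= /andP[].
  by rewrite !inE => /andP[xD _] /andP[xD' _]; apply: DD' xD xD'.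
have cI : #|I| < m by rewrite -ltn_double -cov2.
have cfI : #|f @: I| = #|I| := card_imset _ (can_inj fK).
have /card_gt0P[x0] : 0 < #|D :\: covered f| by rewrite cardsD subn_gt0 (leq_trans cI).
have /card_gt0P[y0] : 0 < #|D' :\: covered f| by rewrite cardsD fI cfI subn_gt0 (leq_trans cI).
rewrite !inE !negbK => /andP[/eqP fy0 y0D'] /andP[/eqP fx0 x0D].
have noaug x y : x \in D -> y \in D' -> f x = x -> e x y -> f y != y.
  move=> xD yD' fx exy; apply: (maximum_matching_maximal es' ei' maxf Hf erefl _ fx).
  by rewrite /e' exy xD yD'.
(* [x0] and [y0] are uncovered. Matched vertices of [D] outside [J] are non-neighbours of [y0], and
   the partners of those in [J] are non-neighbours of [x0]; adding the two bounds counts the edges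
   of [f] only once. *)
pose J := [set x in I | e x y0].
have H1 : (D :\: covered f) :|: (I :\: J) \subset [set x in D | ~~ e x y0].
  apply/subsetP=> x; rewrite !inE => /orP[/andP[]|/andP[H /andP[xD fx]]]; last first.
    by rewrite xD /=; move: H; rewrite xD fx.
  rewrite negbK => /eqP fx xD; rewrite xD /=; apply/negP=> exy.
  by have := noaug _ _ xD y0D' fx exy; rewrite fy0 eqxx.
have H2 : (D' :\: covered f) :|: f @: J \subset [set y in D' | ~~ e x0 y].
  apply/subsetP=> y; rewrite !inE => /orP[/andP[]|/imsetP[x]].
    rewrite negbK => /eqP fy yD'; rewrite yD' /=; apply/negP=> exy.
    by have := noaug _ _ x0D yD' fx0 exy; rewrite fy eqxx.
  rewrite !inE => /andP[/andP[xD fx] exy0] ->; rewrite fD //=; apply/negP=> e0.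
  have ey0x : e' y0 x by rewrite /e' e_sym exy0 xD y0D' orbT.
  have [h [Hh Ch hy0 hx ho]] := matching_exchange es' ei' Hf ey0x fy0 fx.
  have ch : #|covered h| = #|covered f|.
    rewrite Ch cardsU1 !inE fy0 eqxx andbF [in RHS](cardsD1 (f x)) inE fK.
    by rewrite eq_sym fx.
  have hx0 : h x0 = x0.
    rewrite ho //; first by apply/eqP=> E; apply: DD' x0D _; rewrite E.
      by apply: contraNneq fx => <-; rewrite fx0.
    by apply: contraNneq fx => E; rewrite -{2}(fK x) -E fx0.
  have maxh g : matching e' g -> #|covered g| <= #|covered h| by rewrite ch; apply: maxf.
  have e0' : e' x0 (f x) by rewrite /e' e0 x0D fD.
  have := maximum_matching_maximal es' ei' maxh Hh erefl e0' hx0.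
  have : f x \notin covered h.
    rewrite Ch !inE eqxx /= orbF; apply: contraNneq fx => E.
    by rewrite -{2}(fK x) E fy0.
  by rewrite inE negbK => ->.
have := leq_trans (subset_leq_card H1) (Hbe _ y0D').
have := leq_trans (subset_leq_card H2) (Hal _ x0D).
have JI : J \subset I by apply/subsetP=> x; rewrite inE => /andP[].
have disjU (B C : {set V}) : [disjoint B & C] -> #|B :|: C| = #|B| + #|C|.
  by move=> /disjoint_setI0 E; rewrite cardsU E cards0 subn0.
rewrite !disjU ?(card_imset _ (can_inj fK)).
- have := cardsID (covered f) D; have := cardsID (covered f) D'.
  have := cardsID J I; rewrite fI cfI (setIidPr JI) -/I.
  by move: cI; clear; lia.
- by apply/pred0P=> x; apply/negP=> /= /andP[]; rewrite !inE => /andP[/negPf-> _]; rewrite !andbF.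
- apply/pred0P=> x; apply/negP=> /= /andP[]; rewrite !inE => /andP[fx _].
  by case/imsetP=> y; rewrite !inE => /andP[/andP[_ fy] _] E; rewrite E fK eq_sym fy in fx.
Qed.
End Decomposition.
End Matchings.

(** * From a matching in a blue neighbourhood to a blue fan *)

Lemma compl_graph_sym (V : finType) (G : rel V) : symmetric G -> symmetric (compl_graph G).
Proof. by move=> Gs x y; rewrite /compl_graph Gs eq_sym. Qed.

Lemma compl_graph_irr (V : finType) (G : rel V) : irreflexive (compl_graph G).
Proof. by move=> x; rewrite /compl_graph eqxx. Qed.

Lemma fan_of_matching (V : finType) (G : rel V) m w (f : {ffun V -> V}) :
  symmetric G -> matching (compl_graph G) f ->
  (forall x, f x != x -> compl_graph G w x) -> m.*2 <= #|covered f| ->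
  contains_subgraph (compl_graph G) (fan m).
Proof.
move=> Gs Hf wf cf; have Bs := compl_graph_sym Gs.
have [s0 [us0 cs0]] := matching_pairs Hf.
have sz0 : m <= size s0.
  by rewrite -leq_double; move: cf; rewrite (eq_card cs0) (card_uniqP us0) size_cat size_map addnn.
pose s := take m s0.
have sz : size s = m by rewrite size_takel.
have cs x : x \in s ++ map f s -> f x != x.
  have : x \in s0 ++ map f s0 -> f x != x by rewrite -cs0 inE.
  rewrite !mem_cat => H /orP[/mem_take xs|xs]; apply: H; rewrite ?xs //.
  by rewrite /s map_take in xs; rewrite (mem_take xs) orbT.
have us : uniq (w :: s ++ map f s).
  rewrite cons_uniq; apply/andP; split.
    by apply/negP=> /cs /wf; rewrite compl_graph_irr.
  move: us0; rewrite !cat_uniq => /and3P[u1 /hasPn u2 u3].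
  rewrite map_take !take_uniq // andbT /=; apply/hasPn=> x /mem_take/u2.
  by apply: contra => /mem_take.
pose L := w :: s ++ map f s.
have sL : size L = 2 * m + 1 by rewrite /= size_cat size_map sz addnn mul2n addn1.
(* Fan vertices [2k + 1] and [2k + 2] go to the [k]-th listed vertex and its partner; in [L] these
   stand at [k + 1] and [m + k + 1], after the centre [w]. *)
pose pos (i : nat) := if i == 0 then 0 else if odd i then 1 + i./2 else m + i./2.
have posL (i : 'I_(2 * m + 1)) : pos i < size L.
  by have := ltn_ord i; rewrite sL /pos; clear; case: ifP; [|case: ifP]; lia.
have n1 k : k < m -> nth w L k.+1 = nth w s k by move=> km; rewrite /= nth_cat sz km.
have n2 k : k < m -> nth w L (m + k.+1) = f (nth w s k).
  by move=> km; rewrite addnS /= nth_cat sz ltnNge leq_addr /= addKn (nth_map w) ?sz.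
have e0 (i : 'I_(2 * m + 1)) : i != 0 :> nat -> compl_graph G w (nth w L (pos i)).
  move=> i0; apply: wf; apply: cs.
  have [p Ep] : exists p, pos i = p.+1.
    rewrite /pos (negPf i0); case: ifP => io; [by exists i./2 | exists (m + i./2).-1].
    by move: i0 io; clear; lia.
  have := posL i; rewrite Ep /= => H; exact: mem_nth.
have e1 k : k < m -> compl_graph G (nth w s k) (f (nth w s k)).
  move=> km; apply: matching_edge Hf _; apply: cs.
  by rewrite mem_cat mem_nth ?sz.
exists (fun i : 'I_(2 * m + 1) => nth w L (pos i)); split.
  move=> i j /eqP; rewrite nth_uniq ?posL // => /eqP E; apply: val_inj => /=.
  by move: E (ltn_ord i) (ltn_ord j); rewrite /pos; clear; do ![case: ifP]; lia.
move=> i j; rewrite /fan => /andP[nij] /or3P[/eqP i0|/eqP j0|/eqP E].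
- by rewrite {1}/pos i0 e0 //; apply: contraNneq nij => j0; apply/eqP/val_inj; rewrite /= i0 j0.
- by rewrite Bs {1}/pos j0 e0 //; apply: contraNneq nij => i0; apply/eqP/val_inj; rewrite /= i0 j0.
have [i0|i0] := eqVneq (val i) 0.
  by rewrite {1}/pos i0 e0 //; apply: contraNneq nij => j0; apply/eqP/val_inj; rewrite /= i0 j0.
have [j0|j0] := eqVneq (val j) 0.
  by rewrite Bs {1}/pos j0 e0 //.
have nij' : val i != val j by [].
pose k := (val i).-1./2.
have km : k < m by have := ltn_ord i; move: i0; rewrite /k; clear => /=; lia.
wlog io : i j nij nij' i0 j0 E @k km / odd i => [hw|].
  have [io|ie] := boolP (odd i); first exact: (hw i j).
  rewrite Bs; apply: (hw j i) => //; rewrite 1?eq_sym -?E //.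
  by move: nij' i0 j0 E ie; clear => /=; lia.
have -> : pos i = k.+1 by rewrite /pos (negPf i0) io /k; move: io; clear => /=; lia.
have -> : pos j = m + k.+1.
  by rewrite /pos (negPf j0) /k; move: io nij' i0 j0 E; clear => /=; case: ifP; lia.
by rewrite n1 // n2 // e1.
Qed.

(** * Trees *)

Section Rooting.
Variables (U : finType) (T : rel U).

(* [par] maps every vertex but the root [r] to its only neighbour of smaller
   [idx]; at the root its value is the junk value [r]. *)
Definition rooted (r : U) (par : U -> U) (idx : U -> nat) :=
  [/\ injective idx, par r = r, forall x, x != r -> idx (par x) < idx x &
    forall x y, T x y = (x != r) && (y == par x) || (y != r) && (x == par y)].

(** A repetition-free path from [x] to [y] inside [X] would close up through [z] to a cycle. *)
Lemma acyclic_nbrs_disconnected x y (X : {set U}) z : symmetric T -> acyclic_graph T ->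
  connect (rel_on X T) x y -> x \in X -> x != y -> z \notin X ->
  T z x -> T z y -> False.
Proof.
move=> Ts Ta /connectP[p pp ->] xX nxy zX zx zy.
case/shortenP: pp nxy zy => q pq uq _ nxy zy.
have qX : all (mem X) (x :: q).
  rewrite /= xX /=; elim: q x pq {uq nxy zy zx xX} => //= b q IH a /andP[/and3P[_ bX _] /IH ->].
  by rewrite andbT.
apply: (negP (Ta [:: z, x & q] _ _)).
- by rewrite cons_uniq uq andbT; apply: contra zX => /(allP qX).
- by case: q nxy {pq uq zy qX} => //=; rewrite eqxx.
- rewrite /= rcons_path zx Ts zy andbT.
  by apply: sub_path pq => a b /and3P[].
Qed.

(** The tree is grown one vertex at a time along an edge leaving [X], and [idx] records the time of
    insertion. By acyclicity the new vertex has a single neighbour in [X], its parent. *)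
Lemma rooted_partial r k : is_tree T -> k < #|U| ->
  exists (X : {set U}) par idx, [/\ #|X| = k.+1, r \in X, par r = r,
    {in X &, injective idx} /\ (forall x, x \in X -> idx x < k.+1) &
    (forall x, x \in X -> x != r -> par x \in X /\ idx (par x) < idx x) /\
    {in X &, forall x y, T x y = (x != r) && (y == par x) || (y != r) && (x == par y)}].
Proof.
move=> [[Ts Ti] [Tc Ta]]; elim: k => [|k IH] kU.
  exists [set r], id, (fun=> 0); rewrite cards1 inE; split=> //.
    by split=> // x y /set1P -> /set1P ->.
  by split=> [x /set1P->|x y /set1P -> /set1P ->]; rewrite ?Ti eqxx.
have [X [par [idx [cX rX parr [idxI idxX] [parX TX]]]]] := IH (ltnW kU).
have [x [y [xX yX Txy]]] : exists x y, [/\ x \in X, y \notin X & T x y].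
  have [z zX] : exists z, z \notin X.
    have : 0 < #|~: X| by rewrite cardsCs setCK cX subn_gt0.
    by case/card_gt0P=> z; rewrite inE; exists z.
  have [/exists_inP[x xX /exists_inP[y yX xy]]|] := boolP [exists x in X, [exists y in ~: X, T x y]].
    by exists x, y; rewrite inE in yX.
  rewrite negb_exists_in => /forall_inP H.
  have cl : closed T (mem X).
    have cl1 a b : T a b -> a \in X -> b \in X.
      move=> Tab aX; apply/negPn/negP=> bX; have := H _ aX.
      by move/exists_inP; apply; exists b; rewrite // inE.
    by move=> a b Tab; apply/idP/idP; apply: cl1; rewrite // Ts.
  by have := closed_connect cl (Tc r z); rewrite rX (negPf zX).
have toroot a : a \in X -> connect (rel_on X T) a r.
  have [i] := ubnP (idx a); elim: i a => // i IHi a ai aX.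
  have [->//|ar] := eqVneq a r.
  have [pX pa] := parX _ aX ar.
  apply: connect_trans (IHi _ _ pX); last by apply: leq_trans pa _.
  by apply: connect1; rewrite /rel_on aX pX TX // ar eqxx.
have Xs : connect_sym (rel_on X T) by apply: sym_connect_sym; apply: rel_on_sym.
have uniqx a : a \in X -> T y a -> a = x.
  move=> aX ya; apply/eqP/negPn/negP=> ax.
  apply: (acyclic_nbrs_disconnected (X := X) Ts Ta _ aX ax yX ya); last by rewrite Ts.
  by apply: connect_trans (toroot _ aX) _; rewrite Xs toroot.
have nyr : y != r by apply: contraNneq yX => ->.
have nX a : a \in X -> (a == y) = false by move=> aX; apply: contraNF yX => /eqP <-.
have parX' a : a \in X -> par a \in X.
  by move=> aX; have [->|ar] := eqVneq a r; [rewrite parr | case: (parX a aX ar)].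
exists (y |: X), (fun v => if v == y then x else par v), (fun v => if v == y then k.+1 else idx v).
rewrite cardsU1 yX cX !inE rX orbT nX //; split=> //.
  split=> [a b|a]; last first.
    rewrite !inE => /orP[/eqP->|aX]; rewrite ?eqxx ?nX //.
    by rewrite (ltn_trans (idxX _ aX)).
  rewrite !inE => /orP[/eqP->|aX] /orP[/eqP->|bX]; rewrite ?eqxx ?nX //.
  + by move=> E; have := idxX _ bX; rewrite -E ltnn.
  + by move=> E; have := idxX _ aX; rewrite E ltnn.
  + exact: idxI.
split.
  move=> a; rewrite !inE => /orP[/eqP->|aX] ar; rewrite ?eqxx.
    by rewrite nX // xX orbT; split=> //; apply: idxX.
  have [pX pa] := parX _ aX ar.
  by rewrite (nX a) // (nX (par a)) // pX.
move=> a b; rewrite !inE => /orP[/eqP->|aX] /orP[/eqP->|bX]; rewrite ?eqxx ?nX ?nyr //=.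
- by rewrite Ti orbb eq_sym nX.
- rewrite (eq_sym y (par b)) nX ?parX' // andbF orbF.
  by apply/idP/eqP=> [/uniqx|->]; [apply | rewrite Ts].
- rewrite (eq_sym y (par a)) nX ?parX' // andbF orFb.
  by rewrite Ts; apply/idP/eqP=> [/uniqx|->]; [apply | rewrite Ts].
- exact: TX.
Qed.

Lemma tree_rooted r : is_tree T -> exists par idx, rooted r par idx.
Proof.
move=> Tt; have U0 : 0 < #|U| by apply/card_gt0P; exists r.
have [|X [par [idx [cX rX parr [idxI _] [parX TX]]]]] := @rooted_partial r #|U|.-1 Tt.
  by rewrite prednK.
have XT x : x \in X.
  have /setP/(_ x) : X = [set: U].
    by apply/eqP; rewrite eqEcard subsetT cardsT cX prednK /=.
  by rewrite inE.
exists par, idx; split=> //.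
- by move=> x y; apply: idxI.
- by move=> x /(parX _ (XT x))[].
- by move=> x y; apply: TX.
Qed.
End Rooting.

Lemma leq_card_bigcup (I V : finType) (P : {set I}) (F : I -> {set V}) :
  #|\bigcup_(i in P) F i| <= \sum_(i in P) #|F i|.
Proof.
apply: (big_ind2 (fun (X : {set V}) k => #|X| <= k)) => [|X k X' k' h h'|//]; first by rewrite cards0.
by rewrite (leq_trans (leq_card_setU _ _)) // leq_add.
Qed.

Lemma subset_of_card (V : finType) (A : {set V}) k :
  k <= #|A| -> exists2 B : {set V}, B \subset A & #|B| = k.
Proof.
case/card_geqP=> s [us <- sA]; exists [set x in s].
  by apply/subsetP=> x; rewrite inE => /sA.
by rewrite cardsE; apply/card_uniqP.
Qed.

(** * Degrees, leaves and independent sets of a tree *)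

Section Tree.
Variables (U : finType) (T : rel U).
Hypothesis Ttree : is_tree T.
Implicit Types (x y z : U) (X Y : {set U}).

Definition nbrs x := [set y | T x y].
Definition leaves := [set x | #|nbrs x| == 1].

Let Ts : symmetric T := proj1 (proj1 Ttree).
Let Ti : irreflexive T := proj2 (proj1 Ttree).

Lemma leaf_nbr x y z : x \in leaves -> T x y -> T x z -> y = z.
Proof.
rewrite inE => /cards1P[w E] xy xz.
have : y \in nbrs x by rewrite inE.
have : z \in nbrs x by rewrite inE.
by rewrite E => /set1P-> /set1P->.
Qed.

(** A vertex [v] of [Y] of largest [idx] has at most its parent as a neighbour in [Y]. Put [v] into
    [I], delete both and recurse: each chosen vertex costs at most two. *)
Lemma independent_half Y : exists I : {set U},
  [/\ I \subset Y, {in I &, forall x y, ~~ T x y} & #|Y| <= 2 * #|I|].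
Proof.
have [k] := ubnP #|Y|; elim: k Y => // k IH Y; rewrite ltnS => cY.
have [->|[r rY]] := set_0Vmem Y.
  by exists set0; rewrite sub0set cards0; split=> // x y; rewrite inE.
have [par [idx [idxI parr idxp TE]]] := tree_rooted r Ttree.
have [v [vY vmax]] : exists v, v \in Y /\ forall y, y \in Y -> idx y <= idx v.
  by case: (arg_maxnP idx rY) => v; exists v.
have [|I [IY Iind cI]] := IH (Y :\ v :\ par v).
  apply: leq_trans cY; rewrite [X in _ < X](cardsD1 v) vY ltnS.
  exact/subset_leq_card/subD1set.
exists (v |: I); have vI : v \notin I by apply: contraTN IY => vI; apply/subsetPn; exists v; rewrite // !inE eqxx andbF.
have vy y : y \in I -> ~~ T v y.
  move=> /(subsetP IY); rewrite !inE => /and3P[yp yv yY].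
  rewrite TE (negPf yp) andbF /=; apply/negP=> /andP[yr /eqP E].
  by have := vmax _ yY; rewrite leqNgt E idxp.
split.
- by rewrite subUset sub1set vY (subset_trans IY) // (subset_trans (subD1set _ _)) // subD1set.
- move=> x y; rewrite !inE => /orP[/eqP->|xI] /orP[/eqP->|yI].
  + by rewrite Ti.
  + exact: vy.
  + by rewrite Ts vy.
  + exact: Iind.
- rewrite cardsU1 vI (cardsD1 v) vY mulnDr; apply: leq_trans (_ : 1 + (1 + #|Y :\ v :\ par v|) <= _).
    by rewrite leq_add2l [X in X <= _](cardsD1 (par v)) leq_add2r leq_b1.
  by rewrite addnA leq_add2l.
Qed.

(** Every non-root vertex accounts for one edge, counted once from the child and once from the
    parent; [F x y] says that [y] is the parent of [x]. *)
Lemma degree_sum : \sum_x #|nbrs x| = 2 * (#|U| - 1).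
Proof.
have [U0|[r _]] := set_0Vmem [set: U].
  have c0 : #|U| = 0 by rewrite -cardsT U0 cards0.
  by rewrite c0 muln0 big1 // => x _; have := card0_eq c0 x; rewrite inE.
have [par [idx [idxI parr idxp TE]]] := tree_rooted r Ttree.
pose F x y : nat := (x != r) && (y == par x).
have E x : #|nbrs x| = \sum_y (F x y + F y x).
  rewrite -sum1_card big_mkcond /=; apply: eq_bigr => y _; rewrite inE TE /F.
  have := idxp x; have := idxp y; case: (x != r); case: (y != r) => //=.
  - case: eqP => [<-|_]; case: eqP => [<-|_] //= /(_ isT) H1 /(_ isT) H2.
    by have := ltn_trans H1 H2; rewrite ltnn.
  - by rewrite ?orbF ?addn0; case: (y == par x).
rewrite (eq_bigr _ (fun x _ => E x)).
rewrite (eq_bigr (fun x => \sum_y F x y + \sum_y F y x)); last by move=> x _; rewrite big_split.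
rewrite big_split /= [X in _ + X]exchange_big /= addnn -mul2n; congr (_ * _).
rewrite (eq_bigr (fun x => (x != r) : nat)); last first.
  move=> x _; rewrite (bigD1 (par x)) //= big1 ?addn0 /F ?eqxx ?andbT // => y.
  by move=> /negPf->; rewrite andbF.
by rewrite -big_mkcond sum1_card -cardsT (cardsD1 r) inE addKn; apply: eq_card => x; rewrite !inE andbT.
Qed.

Hypothesis U2 : 2 <= #|U|.

Lemma nbrs_gt0 x : 0 < #|nbrs x|.
Proof.
have [y yx] : exists y, y != x.
  have : 0 < #|[set~ x]| by rewrite cardsC1; case: #|U| U2 => [|[]].
  by case/card_gt0P=> y; rewrite !inE; exists y.
have /connectP[[|z p] /= pp yE] := proj1 (proj2 Ttree) x y.
  by rewrite yE eqxx in yx.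
by apply/card_gt0P; exists z; rewrite inE; case/andP: pp.
Qed.

(** Two adjacent leaves would form a whole component. *)
Lemma leaves_nonadjacent x y : 3 <= #|U| -> x \in leaves -> y \in leaves -> ~~ T x y.
Proof.
move=> U3 xl yl; apply/negP=> Txy.
have cl : closed T (mem [set x; y]).
  have cl1 a b : T a b -> a \in [set x; y] -> b \in [set x; y].
    rewrite !inE => Tab /orP[/eqP E|/eqP E]; rewrite E in Tab.
      by rewrite (leaf_nbr xl Tab Txy) eqxx orbT.
    by rewrite Ts in Txy; rewrite (leaf_nbr yl Tab Txy) eqxx.
  by move=> a b Tab; apply/idP/idP; apply: cl1; rewrite // Ts.
have : [set x; y] = setT.
  by apply/setP=> z; have := closed_connect cl (proj1 (proj2 Ttree) x z); rewrite !inE eqxx.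
move/(congr1 (fun A : {set U} => #|A|)); rewrite cardsT cards2 => E.
by move: U3; rewrite -E; case: (x != y).
Qed.

(** Subtraction is truncated, so a vertex of degree [d >= 1] satisfies [d + [d = 1] = 2 + (d - 2)];
    sum this over the tree. *)
Lemma excess_degree : \sum_x (#|nbrs x| - 2) + 2 = #|leaves|.
Proof.
have E : \sum_x (#|nbrs x| + (x \in leaves)) = \sum_x (2 + (#|nbrs x| - 2)).
  apply: eq_bigr => x _; rewrite inE; have := nbrs_gt0 x.
  by case: #|nbrs x| => [|[|k]] //= _; rewrite addn0 !subSS subn0.
move: E; rewrite !big_split /= degree_sum sum_nat_const.
rewrite (_ : \sum_x (x \in leaves : nat) = #|leaves|); last first.
  by rewrite -sum1_card [RHS]big_mkcond; apply: eq_bigr => x _; case: (x \in leaves).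
by move: U2; rewrite [#|xpredT|]cardT -cardE; clear; lia.
Qed.

(** Rooted at [u], each non-leaf neighbour of [u] has a child of its own, and these children are
    distinct and lie outside the closed neighbourhood of [u]. *)
Lemma hub_degree u : #|nbrs u| + #|nbrs u :\: leaves| < #|U|.
Proof.
have [par [idx [idxI paru idxp TE]]] := tree_rooted u Ttree.
have nu x : x \in nbrs u -> x != u /\ par x = u.
  by rewrite inE TE eqxx /= => /andP[xu /eqP].
pose phi c := odflt u [pick x | (x != u) && (par x == c)].
have phiP c : c \in nbrs u :\: leaves -> phi c != u /\ par (phi c) = c.
  rewrite inE => /andP[cl cu]; have [cnu pc] := nu _ cu.
  rewrite /phi; case: pickP => [x /andP[xu /eqP]//|none].
  case/negP: cl; rewrite inE; apply/cards1P; exists u.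
  apply/setP=> x; rewrite !inE TE cnu pc /= (eq_sym c).
  by have := none x; case: (x != u) => //=; rewrite ?orbF // => ->; rewrite orbF.
have phiI : {in nbrs u :\: leaves &, injective phi}.
  by move=> c d /phiP[_ pc] /phiP[_ pd] E; rewrite -pc -pd E.
have sub : phi @: (nbrs u :\: leaves) \subset ~: (u |: nbrs u).
  apply/subsetP=> _ /imsetP[c cN ->]; have [pu pc] := phiP _ cN.
  rewrite !inE negb_or pu /=; apply/negP=> H.
  have [|_ E] := nu (phi c); first by rewrite inE.
  by have := nu c (subsetP (subsetDl _ _) _ cN); rewrite -pc E eqxx => -[].
have := subset_leq_card sub; have := cardsC (u |: nbrs u).
rewrite card_in_imset // cardsU1 inE Ti.
by move: U2; clear; lia.
Qed.

(** If some [u] sees [h] leaves, take [h] of them and [s - h <= h] leaves not adjacent to [u]: a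
    vertex other than [u] sees only the latter. If there is no such [u], any [s] leaves will do. *)
Lemma flat_leaves s h : h <= s -> s <= 2 * h -> 2 * s - 1 <= #|leaves| ->
  (forall y, #|nbrs y :&: leaves| < s) ->
  exists L : {set U}, [/\ L \subset leaves, #|L| = s & forall p, #|nbrs p :&: L| <= h].
Proof.
move=> hs sh cl Hy.
have [/existsP[u hu]|] := boolP [exists u, h <= #|nbrs u :&: leaves|]; last first.
  rewrite negb_exists => /forallP H.
  have [|L LL cL] := @subset_of_card _ leaves s; first by apply: leq_trans cl; move: (Hy); clear; case: s => [|s]; lia.
  exists L; split=> // p; have := H p; rewrite -ltnNge => /ltnW; apply: leq_trans.
  by rewrite subset_leq_card // setIS.
have [A AL cA] := subset_of_card hu.
have [|B BL cB] := @subset_of_card _ (leaves :\: nbrs u) (s - h).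
  rewrite cardsD setIC; have := Hy u; move: cl hs; clear.
  by lia.
have dAB : [disjoint A & B].
  apply/pred0P=> x; apply/negP=> /= /andP[/(subsetP AL) xA /(subsetP BL)].
  by move: xA; rewrite !inE => /andP[-> _].
exists (A :|: B); split.
- rewrite subUset (subset_trans AL) ?subsetIr //=.
  by rewrite (subset_trans BL) // subsetDl.
- by rewrite cardsU disjoint_setI0 // cards0 subn0 cA cB subnKC.
move=> p; have [->|pu] := eqVneq p u.
  rewrite -cA subset_leq_card //; apply/subsetP=> x; rewrite !inE => /andP[ux /orP[//|xB]].
  by have := subsetP BL _ xB; rewrite !inE ux.
apply: (@leq_trans #|B|); last by rewrite cB; move: sh; clear; lia.
rewrite subset_leq_card //; apply/subsetP=> x; rewrite !inE => /andP[px /orP[xA|//]].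
have := subsetP AL _ xA; rewrite inE => /andP[ux xl]; rewrite inE in ux.
by case/eqP: pu; apply: (leaf_nbr xl); rewrite Ts.
Qed.

(* Every vertex of degree at most [2] meets the union of the closed
   neighbourhoods of the neighbours of a maximal packing, whose size is
   bounded through [excess_degree]. *)
Lemma closed_nbrs_packing k : 6 * k + 2 * #|leaves| < #|U| + 10 ->
  exists D : {set U}, [/\ #|D| = k, {in D, forall q, #|nbrs q| <= 2} &
    {in D &, forall q q', q != q' -> [disjoint q |: nbrs q & q' |: nbrs q']}].
Proof.
elim: k => [|k IH] Hk; first by exists set0; rewrite cards0; split=> // x; rewrite inE.
have [|D [cD D2 Dd]] := IH; first by move: Hk; clear; lia.
pose Y := \bigcup_(q in D) nbrs q; pose B := \bigcup_(y in Y) (y |: nbrs y).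
have cY : #|Y| <= 2 * k.
  rewrite (leq_trans (leq_card_bigcup _ _)) // -cD mulnC -sum_nat_const.
  by apply: leq_sum => q /D2.
have cB : #|B| <= 3 * #|Y| + \sum_x (#|nbrs x| - 2).
  rewrite (leq_trans (leq_card_bigcup _ _)) //.
  apply: (@leq_trans (\sum_(y in Y) (3 + (#|nbrs y| - 2)))).
    by apply: leq_sum => y _; rewrite cardsU1; case: (y \notin _); lia.
  rewrite big_split /= sum_nat_const mulnC leq_add2l.
  by rewrite [X in _ <= X](bigID (mem Y)) /= leq_addr.
pose S := [set x | #|nbrs x| <= 2].
have cS : #|U| <= #|S| + \sum_x (#|nbrs x| - 2).
  rewrite -(cardsC S) leq_add2l -sum1_card [X in _ <= X](bigID (mem (~: S))) /=.
  apply: leq_trans (leq_addr _ _); apply: leq_sum => x; rewrite !inE -ltnNge.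
  by rewrite -subn_gt0.
(* If [S] were inside [B], then [#|U| <= 6 k + 2 (#|leaves| - 2)], because the total excess bounds
   both the vertices outside [S] and the part of [#|B|] beyond [3 #|Y|]. The constant [10] is
   [6 + 4]. *)
have [x xS xB] : exists2 x, x \in S & x \notin B.
  have : ~~ (S \subset B).
    apply/negP=> /subset_leq_card; have := excess_degree.
    by move: cB cY cS Hk; clear; lia.
  by case/subsetPn=> x; exists x.
have xD q : q \in D -> [disjoint x |: nbrs x & q |: nbrs q].
  move=> qD; apply/pred0P=> y; apply/negP=> /= /andP[yx yq]; case/negP: xB.
  have [z zq] : exists z, z \in nbrs q by apply/card_gt0P/nbrs_gt0.
  have qB z' : z' \in nbrs q -> z' \in Y by move=> H; apply/bigcupP; exists q.
  have xy : x \in y |: nbrs y by move: yx; rewrite !inE Ts (eq_sym x).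
  have [yN|yN] := boolP (y \in nbrs q).
    by apply/bigcupP; exists y; rewrite ?qB.
  move: yq; rewrite inE (negPf yN) orbF => /set1P yq; rewrite yq in yx xy yN.
  have [xq|xq] := boolP (x \in nbrs q).
    by apply/bigcupP; exists x; rewrite ?qB // setU11.
  move: xy; rewrite inE (negPf xq) orbF => /set1P ->.
  by apply/bigcupP; exists z; rewrite ?qB // !inE Ts; rewrite inE in zq; rewrite zq orbT.
have xnD : x \notin D.
  apply/negP=> /xD /pred0P/(_ x) /=; by rewrite setU11.
exists (x |: D); rewrite cardsU1 xnD cD; split=> // [q|q q']; rewrite !inE.
  by case/orP=> [/eqP->|/D2 //]; rewrite inE in xS.
move=> /orP[/eqP->|qD] /orP[/eqP->|qD']; rewrite ?eqxx // => qq.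
- exact: xD.
- by rewrite disjoint_sym xD.
- exact: Dd.
Qed.

(** * Branches of a rooted tree *)

Section Descendants.
Variables (r : U) (par : U -> U) (idx : U -> nat).
Hypothesis rT : rooted T r par idx.

(** Since [par] fixes the root, reachability under iterated [par] is the ancestor relation; [y] is
    its own descendant. *)
Definition descendants y := [set x | fconnect par x y].

Lemma idx_par x : idx (par x) <= idx x.
Proof.
by case: rT => _ parr idxp _; have [->|/idxp/ltnW//] := eqVneq x r; rewrite parr.
Qed.

Lemma idx_iter i x : idx (iter i par x) <= idx x.
Proof. by elim: i => //= i IH; apply: leq_trans (idx_par _) IH. Qed.

Lemma descendantsP x y : reflect (exists i, iter i par x = y) (x \in descendants y).
Proof.
rewrite inE; apply: (iffP idP) => [/iter_findex E|[i <-]]; last exact: fconnect_iter.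
by exists (findex par x y).
Qed.

Lemma descendants_self y : y \in descendants y.
Proof. by apply/descendantsP; exists 0. Qed.

Lemma descendants_idx x y : x \in descendants y -> idx y <= idx x.
Proof. by case/descendantsP=> i <-; apply: idx_iter. Qed.

Lemma descendants_par x y : x \in descendants y -> x != y -> par x \in descendants y.
Proof.
by case/descendantsP=> [[|i]] /= <-; rewrite ?eqxx // -iterS iterSr => _; apply/descendantsP; exists i.
Qed.

Lemma descendants_child x y : par x \in descendants y -> x \in descendants y.
Proof. by case/descendantsP=> i <-; apply/descendantsP; exists i.+1; rewrite iterSr. Qed.

Lemma descendants_root : descendants r = setT.
Proof.
case: rT => _ parr idxp _; apply/setP=> x; rewrite [RHS]inE.
have [k] := ubnP (idx x); elim: k x => // k IH x xk.
have [->|xr] := eqVneq x r; first exact: descendants_self.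
by apply/descendants_child/IH; rewrite -ltnS; apply: leq_trans xk; rewrite ltnS idxp.
Qed.

Lemma root_descendant c : r \in descendants c -> c = r.
Proof.
move=> /descendants_idx H; case: (rT) => idxI _ _ _; apply/idxI/eqP; rewrite eqn_leq H.
by apply: descendants_idx; rewrite descendants_root inE.
Qed.

Lemma descendants_cut x z y : x \in descendants y -> z \notin descendants y ->
  T x z -> x = y /\ z = par y.
Proof.
case: rT => _ parr idxp TE xy zy; rewrite TE => /orP[]/andP[_ /eqP E]; last first.
  by case/negP: zy; apply: descendants_child; rewrite -E.
have [xE|nxy] := eqVneq x y; first by rewrite -xE.
by case/negP: zy; rewrite E descendants_par.
Qed.

(** Both [c] and [d] lie on the path from [x] to the root. If they differed, one would be an
    ancestor of their common parent, and its [idx] would be below itself. *)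
Lemma descendants_children_disjoint c d x : par c = par d -> c != r -> d != r ->
  x \in descendants c -> x \in descendants d -> c = d.
Proof.
case: rT => _ parr idxp _ E cr dr /descendantsP[i Ei] /descendantsP[j Ej].
wlog ij : c d i j E cr dr Ei Ej / i <= j => [hw|].
  by case/orP: (leq_total i j) => H; [|apply: esym]; [apply: (hw c d i j) | apply: (hw d c j i)].
move: Ej; rewrite -(subnK ij) iterD Ei; case: (j - i) => [//|k]; rewrite iterSr E => Ej.
by have := idx_iter k (par d); rewrite Ej leqNgt idxp.
Qed.

Lemma card_descendants y :
  #|descendants y| <= 1 + \sum_(c in [set c | (c != r) && (par c == y)]) #|descendants c|.
Proof.
set C := [set c | _].
have sub : descendants y \subset y |: \bigcup_(c in C) descendants c.
  apply/subsetP=> x xy; rewrite in_setU1; have [//|nxy /=] := eqVneq x y.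
  have [i Ei] := descendantsP _ _ xy.
  have exi : exists i, iter i par x == y by exists i; apply/eqP.
  case: (ex_minnP exi) => [[|k]] /=; first by rewrite (negPf nxy).
  move=> /eqP Ek kmin; apply/bigcupP; exists (iter k par x); last by apply/descendantsP; exists k.
  (* The root is its own parent but must not count as its own child; if the path already stood at
     the root one step earlier, [k.+1] would not be minimal. *)
  rewrite inE Ek eqxx andbT; apply: contraTneq (leqnn k) => kr.
  rewrite -ltnNge; apply: kmin; rewrite kr -Ek kr.
  by case: rT => _ ->.
apply: leq_trans (subset_leq_card sub) _; rewrite cardsU1.
by rewrite leq_add ?leq_b1 // leq_card_bigcup.
Qed.

(** A descendant of largest [idx] has no child, and it is not [c] because [c] has other
    descendants. *)
Lemma deepest_descendant_leaf c : c != r -> 1 < #|descendants c| ->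
  exists x, [/\ x \in descendants c, par x \in descendants c & x \in leaves].
Proof.
case: (rT) => idxI parr idxp TE cr c1.
have [x [xc xmax]] : exists x, x \in descendants c /\ forall y, y \in descendants c -> idx y <= idx x.
  by case: (arg_maxnP idx (descendants_self c)) => x; exists x.
have xnc : x != c.
  apply: contraTneq c1 => xE; rewrite -leqNgt -(cards1 c) subset_leq_card //.
  apply/subsetP=> y yc; rewrite inE; apply/eqP/idxI/eqP.
  by rewrite eqn_leq (descendants_idx yc) -xE xmax.
have xr : x != r.
  by apply: contraNneq cr => xr; apply/eqP/root_descendant; rewrite -xr.
exists x; split=> //; first exact: descendants_par.
rewrite inE; apply/cards1P; exists (par x); apply/setP=> y; rewrite !inE TE xr /=.
have [yx|] := eqVneq x (par y); last by rewrite andbF orbF.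
have [->|yr] := eqVneq y r; first by rewrite orbF.
have yc : y \in descendants c by apply: descendants_child; rewrite -yx.
by have := xmax _ yc; rewrite leqNgt yx idxp.
Qed.
End Descendants.

(* If the deepest vertex [y] with at least [s] descendants does not give such an
   edge, all branches at [y] are small; hence there are many of them, and leaves
   in different branches have different neighbours. *)
Lemma balanced_edge s h : 0 < h -> s * s < #|U| ->
  (forall y, #|nbrs y :&: leaves| < s) ->
  ~ (exists L : {set U}, [/\ L \subset leaves, #|L| = s & forall p, #|nbrs p :&: L| <= h]) ->
  exists Y z z', [/\ z \in Y, s <= #|Y|, s <= #|~: Y|, T z z' &
    z' \notin Y /\ forall x y, x \in Y -> y \notin Y -> T x y -> x = z /\ y = z'].
Proof.
move=> h0 sU nohub noflat.
have /card_gt0P[r _] := ltnW U2.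
have s0 : 0 < s := leq_ltn_trans (leq0n _) (nohub r).
have sn : s < #|U| by apply: leq_ltn_trans sU; rewrite leq_pmull.
have [par [idx rT]] := tree_rooted r Ttree.
have [idxI parr idxp TE] := rT.
have Pr : s <= #|descendants par r| by rewrite (descendants_root rT) cardsT ltnW.
have [y [sy ymax]] : exists y, s <= #|descendants par y| /\
    forall x, s <= #|descendants par x| -> idx x <= idx y.
  by case: (arg_maxnP (P := fun y => s <= #|descendants par y|) idx Pr) => y; exists y.
have [big|small] := leqP s #|~: descendants par y|.
  have yr : y != r by apply: contraTneq big => ->; rewrite (descendants_root rT) setCT cards0 -ltnNge.
  exists (descendants par y), y, (par y); split=> //.
  - exact: descendants_self.
  - by rewrite TE yr eqxx.
  split; last by move=> a b aY bY; apply: (descendants_cut rT aY bY).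
  by apply/negP=> /(descendants_idx rT); rewrite leqNgt idxp.
case: noflat.
set C := [set c | (c != r) && (par c == y)].
(* Children of [y] outside [C2] are leaves, fewer than [s] by [nohub]; a branch in [C2] contains a
   leaf together with its neighbour. *)
pose C2 := [set c in C | 1 < #|descendants par c|].
have cC c : c \in C -> #|descendants par c| <= s.-1.
  rewrite inE => /andP[cr /eqP cy]; rewrite -ltnS prednK // ltnNge; apply/negP=> /ymax.
  by rewrite leqNgt -cy idxp.
have c1 : #|C :\: C2| <= s.-1.
  rewrite -ltnS prednK //; apply: leq_ltn_trans (nohub y); apply: subset_leq_card.
  apply/subsetP=> c; rewrite !inE => /andP[H cC']; have /andP[cr /eqP cy] := cC'.
  rewrite cC' /= -leqNgt in H.
  rewrite TE cr cy eqxx orbT /=; apply/cards1P; exists y.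
  apply/setP=> x; rewrite !inE TE cr cy /=.
  have [E|] := eqVneq c (par x); last by rewrite andbF orbF.
  have [->|xr] := eqVneq x r; first by rewrite orbF.
  have nxc : x != c by apply: contraTneq (idxp _ xr) => xc; rewrite -E xc ltnn.
  have : [set x; c] \subset descendants par c.
    rewrite subUset !sub1set descendants_self andbT.
    by apply: descendants_child; rewrite -E descendants_self.
  by move/subset_leq_card; rewrite cards2 nxc => /leq_trans/(_ H).
(* Otherwise the tree has at most [(s - 1) + 1 + (s - 1) + (s - 1)^2 = s^2] vertices: those not
   below [y], [y] itself, the leaf children and the larger branches. *)
have C2s : s <= #|C2|.
  have H1 := card_descendants rT y; rewrite -/C in H1.
  have H2 : \sum_(c in C) #|descendants par c| <= #|C :\: C2| + #|C2| * s.-1.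
    rewrite (bigID (mem C2)) /= addnC leq_add //.
      rewrite -sum1_card [X in _ <= X](eq_bigl (fun c => (c \in C) && (c \notin C2))).
        by apply: leq_sum => c /andP[cc]; rewrite inE cc /= -leqNgt.
      by move=> c; rewrite inE andbC.
    rewrite -sum_nat_const [X in _ <= X](eq_bigl (fun c => (c \in C) && (c \in C2))).
      by apply: leq_sum => c /andP[/cC].
    by move=> c; rewrite !inE andbA andbb.
  have H3 := cardsC (descendants par y).
  rewrite leqNgt; apply/negP=> lt.
  have H4 : #|C2| * s.-1 <= s.-1 * s.-1 by rewrite leq_mul2r -ltnS prednK // lt orbT.
  by move: s0 sU small c1 H1 H2 H3 H4; clear; case: s => // s; nia.
have [C3 C32 cC3] := subset_of_card C2s.
have C3P c : c \in C3 -> [/\ c != r, par c = y & exists x,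
    [/\ x \in descendants par c, par x \in descendants par c & x \in leaves]].
  move=> /(subsetP C32); rewrite inE [c \in C]inE => /andP[/andP[cr /eqP cy] c2]; split=> //.
  exact: (deepest_descendant_leaf rT cr c2).
pose lam c := odflt c [pick x | [&& x \in descendants par c, par x \in descendants par c & x \in leaves]].
have lamP c : c \in C3 -> [/\ lam c \in descendants par c, par (lam c) \in descendants par c & lam c \in leaves].
  move=> /C3P[_ _ [x [x1 x2 x3]]]; rewrite /lam; case: pickP => [z /and3P[]|/(_ x)] //=.
  by rewrite x1 x2 x3.
have dis c d x : c \in C3 -> d \in C3 -> x \in descendants par c -> x \in descendants par d -> c = d.
  move=> /C3P[cr cy _] /C3P[dr dy _]; apply: (descendants_children_disjoint rT) => //.
  by rewrite cy dy.
have lamI : {in C3 &, injective lam}.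
  move=> c d cC' dC' E; have [H _ _] := lamP _ cC'; have [H' _ _] := lamP _ dC'.
  by apply: (dis _ _ (lam c)) => //; rewrite E.
exists (lam @: C3); split.
- by apply/subsetP=> _ /imsetP[c /lamP[_ _ ?] ->].
- by rewrite card_in_imset.
move=> p; apply: leq_trans h0; rewrite leqNgt; apply/negP=> /card_gt1P[a [b [aP bP]]].
have par_leaf c : c \in C3 -> T p (lam c) -> p = par (lam c).
  move=> cc pc; have [H1 H2 H3] := lamP _ cc.
  rewrite Ts in pc; apply: (leaf_nbr H3 pc); rewrite TE eqxx andbT.
  have [E|//] := eqVneq (lam c) r.
  have [/eqP cr _ _] := C3P _ cc; case: cr.
  by apply: (root_descendant rT); rewrite -E.
move: aP bP; rewrite !inE => /andP[pa /imsetP[c cc aE]] /andP[pb /imsetP[d dd bE]].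
rewrite aE bE in pa pb *.
have [_ Hc _] := lamP _ cc; have [_ Hd _] := lamP _ dd.
rewrite -(par_leaf c) // in Hc; rewrite -(par_leaf d) // in Hd.
by rewrite (dis _ _ _ cc dd Hc Hd) eqxx.
Qed.

(** Greedy embedding in the order of [idx], rooted at [z]. Only [z] may have neighbours outside [Y],
    so the parent of any other vertex of [Y] lies in [Y] and is placed before it. *)
Lemma tree_part_embedding (V : finType) (G : rel V) (Y : {set U}) z (W : {set V}) w0 :
  symmetric G -> irreflexive G -> z \in Y ->
  (forall x y, x \in Y -> x != z -> T x y -> y \in Y) -> w0 \in W ->
  (forall w, w \in W -> #|Y| <= #|[set w' in W | G w w']|.+1) ->
  exists g : U -> V, [/\ g z = w0, {in Y &, injective g}, forall x, x \in Y -> g x \in W &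
    forall x y, x \in Y -> y \in Y -> T x y -> G (g x) (g y)].
Proof.
move=> Gs Gi zY Ycl w0W degW.
have [par [idx [idxI parz idxp TE]]] := tree_rooted z Ttree.
(* [z] belongs to every stage, whatever its [idx], so that the induction starts from [w0]. *)
pose Yk k := [set x in Y | (x == z) || (idx x < k)].
have YkP k : exists g : U -> V, [/\ g z = w0, {in Yk k &, injective g},
    forall x, x \in Yk k -> g x \in W &
    forall x, x \in Yk k -> x != z -> G (g (par x)) (g x)].
  elim: k => [|k [g [gz gI gW gG]]].
    exists (fun=> w0); split=> // [x y|x]; rewrite !inE ?orbF ?ltn0 ?orbF.
      by move=> /andP[_ /eqP->] /andP[_ /eqP->].
    by move=> /andP[_ ->].
  have [/exists_inP[x xY /andP[/eqP xk xz]]|] := boolP [exists x in Y, (idx x == k) && (x != z)]; last first.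
    rewrite negb_exists_in => /forall_inP none.
    have YE : Yk k.+1 = Yk k.
      apply/setP=> x; rewrite !inE; have [xY|//] := boolP (x \in Y).
      have := none _ xY; rewrite ltnS leq_eqVlt; case: (x == z) => //=; rewrite andbT.
      by move/negPf->.
    by exists g; rewrite YE.
  have YE : Yk k.+1 = x |: Yk k.
    apply/setP=> y; rewrite !inE ltnS leq_eqVlt -xk (inj_eq idxI).
    by have [->|] := eqVneq y x; rewrite ?xY ?orbT.
  have xYk : x \notin Yk k by rewrite inE xY (negPf xz) xk ltnn.
  have pY : par x \in Yk k.
    rewrite inE (Ycl x) //= -?xk ?idxp ?orbT //.
    by rewrite TE xz eqxx.
  have [w wN wg] : exists2 w, w \in [set w' in W | G (g (par x)) w'] & w \notin g @: Yk k.
    (* The image of the parent is occupied but is not among its own neighbours, so degree [#|Y| - 1]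
       is enough. *)
    have : ~~ ([set w' in W | G (g (par x)) w'] \subset g @: Yk k :\ g (par x)).
      apply/negP=> /subset_leq_card H.
      have := cardsD1 (g (par x)) (g @: Yk k); rewrite imset_f // card_in_imset // => E.
      have sub : x |: Yk k \subset Y.
        by apply/subsetP=> y; rewrite !inE => /orP[/eqP->|/andP[]].
      have := subset_leq_card sub; rewrite cardsU1 xYk => H'.
      have := degW _ (gW _ pY).
      by move: H E H'; clear; lia.
    case/subsetPn=> w wN; rewrite !inE negb_and negbK => /orP[/eqP E|H]; last by exists w.
    by move: wN; rewrite inE E Gi andbF.
  rewrite inE in wN; case/andP: wN => wW wG.
  pose g' v := if v == x then w else g v.
  have g'x : g' x = w by rewrite /g' eqxx.
  have g'o v : v \in Yk k -> g' v = g v.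
    by move=> vY; rewrite /g'; case: eqP vY xYk => [->|//] ->.
  exists g'; rewrite YE; split.
  - by rewrite /g' eq_sym (negPf xz).
  - move=> a b; rewrite !in_setU1 => /orP[/eqP->|aY] /orP[/eqP->|bY]; rewrite ?g'x ?g'o //.
    + by move=> E; case/negP: wg; rewrite E imset_f.
    + by move=> E; case/negP: wg; rewrite -E imset_f.
    + exact: gI.
  - by move=> a; rewrite in_setU1 => /orP[/eqP->|aY]; rewrite ?g'x ?g'o // gW.
  - move=> a; rewrite in_setU1 => /orP[/eqP->|aY] az; first by rewrite g'x g'o.
    rewrite !g'o ?gG //; move: aY; rewrite !inE (negPf az) /= => /andP[aY ak].
    rewrite (Ycl a) ?TE ?az ?eqxx //=.
    by rewrite (ltn_trans (idxp _ az)) // orbT.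
have [k hk] : exists k, Yk k = Y.
  exists (\max_(x : U) idx x).+1; apply/setP=> x; rewrite inE ltnS (leq_bigmax x) orbT andbT //.
have [g [gz gI gW gG]] := YkP k; rewrite hk in gI gW gG.
exists g; split=> // x y xY yY; rewrite TE => /orP[]/andP[nz /eqP ->].
  by rewrite Gs gG.
exact: gG.
Qed.
End Tree.

(** * Embeddings *)

(** Each set is as large as the whole index set, so representatives can be chosen greedily; [f0]
    only provides values outside [A]. *)
Lemma distinct_representatives (U V : finType) (A : {set U}) (N : U -> {set V}) (f0 : U -> V) :
  (forall x, x \in A -> #|A| <= #|N x|) ->
  exists f : U -> V, {in A &, injective f} /\ forall x, x \in A -> f x \in N x.
Proof.
move=> AN.
suff H k (B : {set U}) : B \subset A -> #|B| = k -> exists f : U -> V,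
    {in B &, injective f} /\ forall x, x \in B -> f x \in N x by exact: (H _ _ (subxx A) erefl).
elim: k B => [|k IH] B BA cB.
  by exists f0; move/eqP: cB; rewrite cards_eq0 => /eqP->; split=> [x y|x]; rewrite inE.
have /card_gt0P[x xB] : 0 < #|B| by rewrite cB.
have cB' : #|B :\ x| = k by move: cB; rewrite (cardsD1 x) xB => -[].
have [f [fI fN]] := IH _ (subset_trans (subD1set B x) BA) cB'.
have [y yN yf] : exists2 y, y \in N x & y \notin f @: (B :\ x).
  apply/subsetPn/negP=> /subset_leq_card; rewrite card_in_imset // cB'.
  have := AN _ (subsetP BA _ xB); have := subset_leq_card BA; rewrite cB => H1 H2 H3.
  by have := leq_trans H1 (leq_trans H2 H3); rewrite ltnn.
exists (fun v => if v == x then y else f v); split.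
  move=> a b aB bB; case: eqP => [->|/eqP ax]; case: eqP => [->|/eqP bx] //.
  - by move=> E; case/negP: yf; rewrite E imset_f // !inE bx.
  - by move=> E; case/negP: yf; rewrite -E imset_f // !inE ax.
  - by apply: fI; rewrite !inE ?ax ?bx.
by move=> a aB; case: eqP => [->//|/eqP ax]; apply: fN; rewrite !inE ax.
Qed.

Lemma contains_subgraph_dec (V W : finType) (G : rel V) (H : rel W) :
  contains_subgraph G H \/ ~ contains_subgraph G H.
Proof.
have [/existsP[f /andP[/injectiveP fI /forallP fH]]|no] :=
    boolP [exists f : {ffun W -> V}, injectiveb f && [forall x, [forall y, H x y ==> G (f x) (f y)]]].
  by left; exists f; split=> // x y; have /forallP/(_ y)/implyP := fH x.
right=> -[f [fI fH]]; case/existsP: no; exists [ffun x => f x]; apply/andP; split.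
  by apply/injectiveP=> x y; rewrite !ffunE => /fI.
by apply/forallP=> x; apply/forallP=> y; apply/implyP=> /fH; rewrite !ffunE.
Qed.

(* The tree vertices outside [L] and [P] go to the free places of [Q] and, once
   these are used up, to [Z], which receives an independent set. *)
Lemma embedding_completion (U V : finType) (T : rel U) (G : rel V) (Q Z : {set V}) (L P : {set U})
    (g : U -> V) :
  is_tree T -> simple_graph G -> [disjoint Q & Z] ->
  (forall x y, x \in Q -> y \in Q :|: Z -> x != y -> G x y) ->
  [disjoint L & P] -> {in L &, injective g} -> {in P &, injective g} ->
  (forall p, p \in P -> g p \in Q) -> (forall l, l \in L -> g l \notin Q :|: Z) ->
  (forall x y, x \in L -> T x y -> y \in L :|: P /\ G (g x) (g y)) ->
  #|U| <= #|L| + #|Q| + #|Z| -> #|U| + #|P| <= #|L| + 2 * #|Q| ->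
  contains_subgraph G T.
Proof.
move=> Tt [Gs Gi] dQZ QG dLP gL gP PQ LK TL c1 c2.
have Ts : symmetric T := proj1 (proj1 Tt).
pose Y := ~: (L :|: P).
have cLP : #|L :|: P| = #|L| + #|P| by rewrite cardsU disjoint_setI0 // cards0 subn0.
have cY := cardsC (L :|: P); rewrite cLP -/Y in cY.
have cgP : #|g @: P| = #|P| by rewrite card_in_imset.
have gPQ : g @: P \subset Q by apply/subsetP=> _ /imsetP[p pP ->]; apply: PQ.
have cQ := cardsID (g @: P) Q; rewrite (setIidPr gPQ) cgP in cQ.
have [I [IY Iind cI]] := independent_half Tt Y.
(* [J] is the overflow that [Q] cannot take. The last hypothesis amounts to [2 #|J| <= #|Y|], so it
   fits into the independent half of [Y]. *)
have [J JI cJ] : exists2 J : {set U}, J \subset I & #|J| = #|U| - #|L| - #|Q|.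
  by apply: subset_of_card; move: cY cI c2; clear; lia.
have JY := subset_trans JI IY.
have [f1 [f1I f1Z]] : exists f : U -> V, {in J &, injective f} /\ forall x, x \in J -> f x \in Z.
  apply: (distinct_representatives (N := fun=> Z) g) => _ _.
  by move: cJ c1; clear; lia.
have [f2 [f2I f2Q]] : exists f : U -> V,
    {in Y :\: J &, injective f} /\ forall x, x \in Y :\: J -> f x \in Q :\: g @: P.
  apply: (distinct_representatives (N := fun=> Q :\: g @: P) g) => _ _.
  by rewrite cardsD (setIidPr JY); move: cJ cY cQ c2; clear; lia.
pose h x := if x \in L :|: P then g x else if x \in J then f1 x else f2 x.
have hLP x : x \in L :|: P -> h x = g x by rewrite /h => ->.
have JnLP x : x \in J -> x \notin L :|: P by move/(subsetP JY); rewrite inE.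
have hJ x : x \in J -> h x = f1 x by move=> xJ; rewrite /h (negPf (JnLP _ xJ)) xJ.
have hR x : x \in Y :\: J -> h x = f2 x.
  by rewrite /h !inE => /andP[/negPf-> /negPf->].
have cases x : [\/ x \in L, x \in P, x \in J | x \in Y :\: J].
  have [xL|xL] := boolP (x \in L); first exact: Or41.
  have [xP|xP] := boolP (x \in P); first exact: Or42.
  have [xJ|xJ] := boolP (x \in J); first exact: Or43.
  by apply: Or44; rewrite !inE xJ negb_or xL.
have QZ v : v \in Q -> v \in Z -> False.
  by move=> vQ vZ; have /pred0P/(_ v) := dQZ; rewrite /= vQ vZ.
have LP x : x \in L -> x \in P -> False.
  by move=> xL xP; have /pred0P/(_ x) := dLP; rewrite /= xL xP.
have inL x : x \in L -> x \in L :|: P by rewrite inE => ->.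
have inP x : x \in P -> x \in L :|: P by rewrite inE orbC => ->.
have hxL x : x \in L -> h x \notin Q :|: Z by move=> xL; rewrite hLP ?inL // LK.
have hxP x : x \in P -> h x \in g @: P by move=> xP; rewrite hLP ?inP // imset_f.
have hxJ x : x \in J -> h x \in Z by move=> xJ; rewrite hJ // f1Z.
have hxR x : x \in Y :\: J -> h x \in Q :\: g @: P by move=> xR; rewrite hR // f2Q.
(* The image of a vertex determines its class among [L], [P], [J] and the rest, which reduces
   injectivity of [h] to each class. *)
have iL x : (x \in L) = (h x \notin Q :|: Z).
  apply/idP/idP=> [/hxL //|]; case: (cases x) => // [/hxP/(subsetP gPQ)|/hxJ|/hxR]; rewrite !inE.
  - by move->.
  - by move->; rewrite orbT.
  - by move=> /andP[_ ->].
have iJ x : (x \in J) = (h x \in Z).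
  apply/idP/idP=> [/hxJ //|]; case: (cases x) => // [/hxL|/hxP/(subsetP gPQ)|/hxR]; rewrite ?inE.
  - by rewrite negb_or => /andP[_ /negPf->].
  - by move=> a /(QZ _ a).
  - by move=> /andP[_ a] /(QZ _ a).
have iP x : (x \in P) = (h x \in g @: P).
  apply/idP/idP=> [/hxP //|]; case: (cases x) => // [/hxL|/hxJ|/hxR].
  - by move=> a /(subsetP gPQ) b; move: a; rewrite inE b.
  - by move=> b /(subsetP gPQ)/QZ/(_ b).
  - by rewrite inE => /andP[/negPf->].
have hI : injective h.
  move=> x y E; have := iL x; have := iP x; have := iJ x; rewrite E -iL -iJ -iP => eJ eP eL.
  case: (cases x) => H.
  - by have yL := H; rewrite eL in yL; apply: gL => //; rewrite -!hLP ?inL.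
  - by have yP := H; rewrite eP in yP; apply: gP => //; rewrite -!hLP ?inP.
  - by have yJ := H; rewrite eJ in yJ; apply: f1I => //; rewrite -!hJ.
  - have yR : y \in Y :\: J by move: H; rewrite !inE eL eP eJ.
    by apply: f2I => //; rewrite -!hR.
exists h; split=> // x y Txy.
have TLh a b : a \in L -> T a b -> G (h a) (h b).
  by move=> aL Tab; have [bLP Gab] := TL _ _ aL Tab; rewrite !hLP // inL.
have [xL|xL] := boolP (x \in L); first exact: TLh.
have [yL|yL] := boolP (y \in L); first by rewrite Gs TLh // Ts.
have hQZ a : a \notin L -> h a \in Q :|: Z by rewrite iL negbK.
have hQ a : a \notin L -> a \notin J -> h a \in Q.
  by move=> /hQZ; rewrite inE => /orP[//|]; rewrite -iJ => ->.
have nxy : h x != h y by rewrite (inj_eq hI); apply: contraTneq Txy => ->; rewrite (proj2 (proj1 Tt)).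
have [xJ|xJ] := boolP (x \in J); last by apply: QG; rewrite ?hQ ?hQZ.
have [yJ|yJ] := boolP (y \in J); last by rewrite Gs; apply: QG; rewrite ?hQ ?hQZ // eq_sym.
by have := Iind _ _ (subsetP JI _ xJ) (subsetP JI _ yJ); rewrite Txy.
Qed.

(** * The upper bound *)

Section UpperBound.
Variables (U V : finType) (T : rel U) (G : rel V) (m n : nat).
Hypotheses (Ttree : is_tree T) (Gsimple : simple_graph G).
Hypotheses (cU : #|U| = n) (cV : #|V| = 2 * n - 1).
Hypotheses (m9 : 9 <= m) (mn : m * m + 1 <= n + m).
Hypotheses (noT : ~ contains_subgraph G T)
  (nofan : ~ contains_subgraph (compl_graph G) (fan m)).

Local Notation B := (compl_graph G).
Let Gs : symmetric G := proj1 Gsimple.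
Let Gi : irreflexive G := proj2 Gsimple.
Let Bs : symmetric B := compl_graph_sym Gs.
Let Bi : irreflexive B := @compl_graph_irr V G.
Let Ts : symmetric T := proj1 (proj1 Ttree).
Let Ti : irreflexive T := proj2 (proj1 Ttree).

(** The slack is at least [(m - 1) (m - 9)]; this bound keeps most later counts linear. *)
Let mn9 : 9 * m <= n + 8.
Proof. by move: m9 mn; clear; nia. Qed.

Let U2 : 2 <= #|U|.
Proof. by rewrite cU; move: m9 mn9; clear; lia. Qed.

Definition red x (A : {set V}) := [set y in A | G x y].
Definition blue x (A : {set V}) := [set y in A | B x y].

Lemma card_red_blue x (A : {set V}) : x \notin A -> #|red x A| + #|blue x A| = #|A|.
Proof.
move=> xA; rewrite -(cardsID [set y | G x y] A); congr (_ + _); apply: eq_card => y.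
  by rewrite !inE.
rewrite !inE andbC /compl_graph; have [yA|] := boolP (y \in A); rewrite ?andbF ?andbT //.
by case: eqP xA => //= ->; rewrite yA.
Qed.

Lemma card_red_blueT x : #|red x setT| + #|blue x setT| + 1 = 2 * n - 1.
Proof.
have := @card_red_blue x [set~ x]; rewrite !inE eqxx => /(_ isT).
rewrite cardsC1 cV => E.
have -> : red x setT = red x [set~ x].
  by apply/setP=> y; rewrite !inE; case: eqP => // ->; rewrite Gi.
have -> : blue x setT = blue x [set~ x].
  by apply/setP=> y; rewrite !inE; case: eqP => // ->; rewrite Bi.
by rewrite E; move: m9 mn9; clear; lia.
Qed.

Lemma blue_matching w (f : {ffun V -> V}) : matching B f ->
  (forall x, f x != x -> B w x) -> #|covered f| < m.*2.
Proof.
move=> Hf Hw; rewrite ltnNge; apply/negP=> H; apply: nofan.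
exact: fan_of_matching Gs Hf Hw H.
Qed.

Definition core a (Q Z : {set V}) := [/\ [disjoint Q & Z], #|Q| + #|Z| + a = n,
  3 * a + #|Z| <= 3 * (m - 1) &
  forall x y, x \in Q -> y \in Q :|: Z -> x != y -> G x y].

(** A blue matching with [m] edges in [A] would be a fan with centre [w], so
    [matching_decomposition] applies in blue with [k = m - 1]. *)
Lemma blue_nbrs_decomposition w (A : {set V}) : (forall x, x \in A -> B w x) ->
  exists a (Q Z : {set V}), [/\ [disjoint Q & Z] /\ Q :|: Z \subset A,
    #|Q| + #|Z| + a = #|A|, 3 * a + #|Z| <= 3 * (m - 1) &
    forall x y, x \in Q -> y \in Q :|: Z -> x != y -> G x y].
Proof.
move=> Aw; have [f Hf|S [Z [SA ZA cSZ H]]] := @matching_decomposition V B Bs Bi (m - 1) A.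
  have Hf' : matching B f by apply: matching_sub Hf => x y /and3P[].
  have := @blue_matching w f Hf'; have := covered_even Hf.
  move=> ev /(_ _) lt; have {lt} : #|covered f| < m.*2.
    by apply: lt => x /(matching_edge Hf)/and3P[xA _ _]; apply: Aw.
  by move: ev; clear; lia.
have dQZ : [disjoint (A :\: S) :\: Z & Z].
  by apply/pred0P=> x; apply/negP=> /= /andP[]; rewrite inE => /andP[/negPf->].
have QZE : (A :\: S) :\: Z :|: Z = A :\: S.
  by apply/setP=> x; rewrite !in_setU in_setD; case: (boolP (x \in Z)) => [/(subsetP ZA) ->|_] /=; rewrite ?orbT ?orbF.
exists #|S|, ((A :\: S) :\: Z), Z; rewrite QZE; split=> //.
- by split=> //; apply: subsetDl.
- have := cardsID S A; rewrite (setIidPr SA); have := cardsID Z (A :\: S).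
  by rewrite (setIidPr ZA); clear; lia.
- move=> x y /setDP[xA xZ] yA nxy; apply/negPn/negP=> nG; case/negP: xZ.
  by apply: (H x y) => //; rewrite /compl_graph nxy.
Qed.

Lemma core_exists w (A : {set V}) : (forall x, x \in A -> B w x) -> n <= #|A| ->
  exists a Q Z, core a Q Z /\ Q :|: Z \subset A.
Proof.
move=> Aw nA; have [A0 A0A cA0] := subset_of_card nA.
have [|a [Q [Z [[dQZ QZA] cQ cZ QG]]]] := @blue_nbrs_decomposition w A0.
  by move=> x /(subsetP A0A)/Aw.
exists a, Q, Z; split; last exact: subset_trans A0A.
by split=> //; rewrite cQ.
Qed.

(** Otherwise [embedding_completion] with empty [L] and [P] embeds [T]: as [n >= 6 (m - 1)], [Q] has
    at least [n / 2] vertices. *)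
Lemma near_complete_small (Q Z : {set V}) : [disjoint Q & Z] ->
  (forall x y, x \in Q -> y \in Q :|: Z -> x != y -> G x y) ->
  #|Z| <= 3 * (m - 1) -> #|Q| + #|Z| < n.
Proof.
move=> dQZ QG cZ; rewrite ltnNge; apply/negP=> cQZ; apply: noT.
have [v0 _] : exists v : V, v \in Q.
  by apply/card_gt0P; move: cQZ cZ m9 mn9; clear; lia.
apply: (embedding_completion (Q := Q) (Z := Z) (L := set0) (P := set0) (g := fun=> v0)) => //.
- by rewrite -setI_eq0 set0I.
- by move=> x y; rewrite inE.
- by move=> x y; rewrite inE.
- by move=> x; rewrite inE.
- by move=> x; rewrite inE.
- by move=> x y; rewrite inE.
- by rewrite cards0 cU.
- by rewrite !cards0 cU; move: cQZ cZ m9 mn9; clear; lia.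
Qed.

Lemma core_gt0 a Q Z : core a Q Z -> 0 < a.
Proof.
case=> dQZ cQ cZ QG; have := near_complete_small dQZ QG.
by move: cQ cZ; clear; lia.
Qed.

Lemma core_bounds a Q Z : core a Q Z ->
  [/\ 0 < a, a < m, n + 2 * a + 3 <= #|Q| + 3 * m & #|~: (Q :|: Z)| + 1 = n + a].
Proof.
move=> H; have a0 := core_gt0 H; case: H => dQZ cQ cZ QG.
have := cardsC (Q :|: Z); rewrite cardsU disjoint_setI0 // cards0 subn0 cV => E.
by split=> //; move: a0 cQ cZ E m9 mn9; clear; lia.
Qed.

(** Otherwise [x] has at least [n + m - 1] blue neighbours, and deleting at most [m - 1] of them
    leaves [n] vertices that host [T]. *)
Lemma red_min_degree x : n <= #|red x setT| + m.
Proof.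
rewrite leqNgt; apply/negP=> lt.
have [|a [Q [Z [[dQZ _] cQ cZ QG]]]] := @blue_nbrs_decomposition x (blue x setT).
  by move=> y; rewrite !inE.
have := near_complete_small dQZ QG; have := card_red_blueT x.
by move: lt cQ cZ m9 mn9; clear; lia.
Qed.

Lemma first_core : exists a Q Z, core a Q Z.
Proof.
have [/existsP[v hv]|] := boolP [exists v, #|red v setT| < n - 1].
  have [| |a [Q [Z [H _]]]] := @core_exists v (blue v setT).
  - by move=> y; rewrite !inE.
  - by have := card_red_blueT v; move: hv m9 mn9; clear; lia.
  by exists a, Q, Z.
rewrite negb_exists => /forallP H; case: noT.
have /card_gt0P[r _] := ltnW U2.
have /card_gt0P[w0 _] : 0 < #|V| by rewrite cV; move: m9 mn9; clear; lia.
have [| | | |g [_ gI _ gT]] := @tree_part_embedding U T Ttree V G setT r setT w0 Gs Gi.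
- by rewrite inE.
- by move=> x y; rewrite !inE.
- by rewrite inE.
- move=> w _; rewrite cardsT cU; have := H w; rewrite -leqNgt /red.
  by move: m9 mn9; clear; lia.
exists g; split=> [x y|x y Txy]; first by apply: gI; rewrite inE.
by apply: gT; rewrite ?inE.
Qed.

(** Of the [n + a - 1] vertices outside the first core fewer than [a] are red to [x], so [n] are
    blue and disjoint from that core. *)
Lemma second_core a Q Z x : core a Q Z -> x \in Q -> #|red x (~: (Q :|: Z))| < a ->
  exists b Q' Z', core b Q' Z' /\ [disjoint Q :|: Z & Q' :|: Z'].
Proof.
move=> H xQ rx; have [a0 am cQ cW] := core_bounds H.
have [| |b [Q' [Z' [H' sub]]]] := @core_exists x (blue x (~: (Q :|: Z))).
- by move=> y; rewrite inE => /andP[].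
- have := @card_red_blue x (~: (Q :|: Z)); rewrite !inE xQ => /(_ isT).
  by move: rx cW; clear; lia.
exists b, Q', Z'; split=> //; rewrite -setI_eq0 -subset0.
apply/subsetP=> y /setIP[y1 /(subsetP sub)]; rewrite inE => /andP[].
by rewrite inE y1.
Qed.

(** Pigeonhole: [(2 n - 1) - (n - a) - (n - b) = a + b - 1] vertices lie outside both cores. *)
Lemma majority a Q Z b Q' Z' (t t' : pred V) : core a Q Z -> core b Q' Z' ->
  [disjoint Q :|: Z & Q' :|: Z'] ->
  (forall w, w \notin Q :|: Z -> w \notin Q' :|: Z' -> t w || t' w) ->
  (exists S : {set V}, [/\ #|S| = a, S \subset ~: (Q :|: Z) & forall w, w \in S -> t w]) \/
  (exists S : {set V}, [/\ #|S| = b, S \subset ~: (Q' :|: Z') & forall w, w \in S -> t' w]).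
Proof.
move=> H H' dK tt; have [a0 _ _ cW] := core_bounds H; have [b0 _ _ cW'] := core_bounds H'.
pose R := ~: (Q :|: Z) :&: ~: (Q' :|: Z').
have cR : #|R| + 1 = a + b.
  have := cardsC R; rewrite setCI !setCK cV cardsU disjoint_setI0 // cards0 subn0.
  have := cardsC (Q :|: Z); have := cardsC (Q' :|: Z'); rewrite cV.
  by move: a0 b0 cW cW' m9 mn9; clear; lia.
have [ha|ha] := leqP a #|[set w in R | t w]|.
  left; have [S SR cS] := subset_of_card ha; exists S; split=> //.
    by apply/subsetP=> w /(subsetP SR); rewrite inE => /andP[/setIP[]].
  by move=> w /(subsetP SR); rewrite inE => /andP[].
have hb : b <= #|[set w in R | ~~ t w]|.
  have := cardsID [set w | t w] R.
  rewrite (_ : R :&: [set w | t w] = [set w in R | t w]); last by apply/setP=> w; rewrite !inE.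
  rewrite (_ : R :\: [set w | t w] = [set w in R | ~~ t w]); last by apply/setP=> w; rewrite !inE andbC.
  by move: ha cR; clear; lia.
right; have [S SR cS] := subset_of_card hb; exists S; split=> //.
  by apply/subsetP=> w /(subsetP SR); rewrite inE => /andP[/setIP[]].
move=> w /(subsetP SR); rewrite inE => /andP[/setIP[]]; rewrite [w \in ~: _]inE => H1.
by rewrite [w \in ~: _]inE => H2; have := tt w H1 H2; case: (t w).
Qed.

(** [bipartite_matching] inside the blue neighbourhood of [w], with [al = a - 1] and [be = b - 1]:
    [m] blue edges there would form a fan with centre [w]. *)
Lemma blue_both_sides a b (D D' : {set V}) w : 0 < a -> 0 < b -> [disjoint D & D'] ->
  (forall x, x \in D -> #|red x D'| < a) -> (forall x, x \in D' -> #|red x D| < b) ->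
  m <= #|blue w D| -> m <= #|blue w D'| -> #|blue w D| + #|blue w D'| + 3 <= a + b + m.
Proof.
move=> a0 b0 dD Da Db hD hD'.
have nB x y (X : {set V}) : x \notin X -> y \in X -> ~~ B x y -> G x y.
  by move=> xX yX; rewrite /compl_graph; case: eqP xX => [->|_ _]; [rewrite yX | rewrite /= negbK].
have nD x : x \in D -> x \notin D'.
  by move=> xD; have /pred0P/(_ x) := dD; rewrite /= xD => /= ->.
have nD' x : x \in D' -> x \notin D by apply: contraL => /nD.
suff : #|blue w D| + #|blue w D'| < (a - 1) + (b - 1) + m by move: a0 b0; clear; lia.
apply: (bipartite_matching Bs Bi) hD hD' _ _.
- rewrite -setI_eq0 -subset0; apply/subsetP=> x; rewrite !inE => /andP[/andP[xD _] /andP[xD' _]].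
  by have := nD _ xD; rewrite xD'.
- move=> f Hf fD; apply: (blue_matching (w := w) Hf) => x /fD.
  by rewrite !inE => /orP[]/andP[].
- move=> x; rewrite inE => /andP[xD _]; rewrite -ltnS subn1 prednK //.
  apply: leq_ltn_trans (Da _ xD); apply: subset_leq_card; apply/subsetP=> y.
  by rewrite !inE => /andP[/andP[yD' _] nb]; rewrite yD' (nB _ _ D') // nD.
- move=> y; rewrite inE => /andP[yD' _]; rewrite -ltnS subn1 prednK //.
  apply: leq_ltn_trans (Db _ yD'); apply: subset_leq_card; apply/subsetP=> x.
  by rewrite !inE => /andP[/andP[xD _] nb]; rewrite xD (nB _ _ D) // ?nD' // Bs.
Qed.

(** * Trees with a vertex that has [m - 1] leaf neighbours *)

Section Hub.
Variable u : U.
Hypothesis hub : m - 1 <= #|nbrs T u :&: leaves T|.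

(** With [u] at [x], [a] red neighbours outside the core would take [a] leaves of [u], and the core
    has room for the rest of [T]. *)
Lemma hub_outside a Q Z x : core a Q Z -> x \in Q -> #|red x (~: (Q :|: Z))| < a.
Proof.
move=> H xQ; have [a0 am cQ cW] := core_bounds H; case: H => dQZ cQZ cZ QG.
rewrite ltnNge; apply/negP=> ha; apply: noT.
have [L LN cL] : exists2 L : {set U}, L \subset nbrs T u :&: leaves T & #|L| = a.
  by apply: subset_of_card; apply: leq_trans hub; move: am; clear; lia.
have LP l : l \in L -> T u l /\ l \in leaves T.
  by move/(subsetP LN); rewrite in_setI [_ \in nbrs _ _]inE => /andP[].
have uL : u \notin L by apply/negP=> /LP[]; rewrite Ti.
have [|f [fI fN]] := @distinct_representatives U V L (fun=> red x (~: (Q :|: Z))) (fun=> x).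
  by move=> l _; rewrite cL.
pose g v := if v == u then x else f v.
have gu : g u = x by rewrite /g eqxx.
have gL l : l \in L -> g l = f l by rewrite /g; case: eqP => // -> lL; rewrite lL in uL.
apply: (embedding_completion (Q := Q) (Z := Z) (L := L) (P := [set u]) (g := g)) => //.
- by rewrite disjoint_sym disjoints1.
- by move=> l l' lL lL'; rewrite !gL //; apply: fI.
- by move=> y y' /set1P-> /set1P->.
- by move=> y /set1P->; rewrite gu.
- by move=> l lL; rewrite gL //; have := fN _ lL; rewrite !inE => /andP[].
- move=> l y lL Tly; have [Tul ll] := LP _ lL; rewrite Ts in Tul.
  rewrite (leaf_nbr ll Tly Tul) !inE eqxx orbT gu gL // Gs; split=> //.
  by have := fN _ lL; rewrite inE => /andP[].
- by rewrite cU cL; move: cQZ; clear; lia.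
- by rewrite cU cL cards1; move: cQ am m9 mn9; clear; lia.
Qed.

(** If both fail, [blue_both_sides] makes [w] red to almost all of [Q] and [Q']. Then [T] embeds
    with [u] at [w], leaves of [u] in [Q'] and its other neighbours in [Q]. *)
Lemma hub_blue a b Q Z Q' Z' w : core a Q Z -> core b Q' Z' ->
  [disjoint Q :|: Z & Q' :|: Z'] -> w \notin Q :|: Z -> w \notin Q' :|: Z' ->
  (#|blue w Q| < m) || (#|blue w Q'| < m).
Proof.
move=> H H' dK wK wK'; have [a0 am cQ cW] := core_bounds H; have [b0 bm cQ' cW'] := core_bounds H'.
apply/negPn/negP; rewrite negb_or -!leqNgt => /andP[hm hm'].
have KK' y : y \in Q :|: Z -> y \notin Q' :|: Z'.
  by move=> yK; have /pred0P/(_ y) := dK; rewrite /= yK => /= ->.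
have dQ : [disjoint Q & Q'].
  rewrite -setI_eq0 -subset0; apply/subsetP=> y /setIP[yQ yQ'].
  by have := KK' y; rewrite !inE yQ yQ' => /(_ isT).
have hmm : #|blue w Q| + #|blue w Q'| + 3 <= a + b + m.
  apply: blue_both_sides => // [x xQ|x xQ'].
  - apply: leq_ltn_trans (hub_outside H xQ); apply: subset_leq_card.
    apply/subsetP=> y; rewrite !inE => /andP[yQ' ->]; rewrite andbT.
    by apply: contraTN yQ' => yK; have := KK' y; rewrite !inE yK negb_or => /(_ isT)/andP[].
  - apply: leq_ltn_trans (hub_outside H' xQ'); apply: subset_leq_card.
    apply/subsetP=> y; rewrite !inE => /andP[yQ ->]; rewrite andbT.
    by have := KK' y; rewrite !inE yQ; apply.
apply: noT; case: H => dQZ cQZ cZ QG.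
(* As many leaves as possible go to [Q']. If all fit, the remaining neighbours number less than
   [n / 2] by [hub_degree]; if not, few neighbours remain because [red w Q'] is nearly all of
   [Q']. *)
pose l' := minn #|nbrs T u :&: leaves T| #|red w Q'|.
have [L LN cL] : exists2 L : {set U}, L \subset nbrs T u :&: leaves T & #|L| = l'.
  by apply: subset_of_card; rewrite geq_minl.
have LP l : l \in L -> T u l /\ l \in leaves T.
  by move/(subsetP LN); rewrite in_setI [_ \in nbrs _ _]inE => /andP[].
have uL : u \notin L by apply/negP=> /LP[]; rewrite Ti.
pose P := nbrs T u :\: L.
have LN' : L \subset nbrs T u := subset_trans LN (subsetIl _ _).
have cP : #|P| + l' = #|nbrs T u| by rewrite -cL -(cardsID L (nbrs T u)) (setIidPr LN') addnC.
have uP : u \notin P by rewrite !inE Ti andbF.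
have wQ : w \notin Q by apply: contra wK; rewrite inE => ->.
have wQ' : w \notin Q' by apply: contra wK'; rewrite inE => ->.
have c1 := card_red_blue wQ; have c2 := card_red_blue wQ'.
have hd := hub_degree Ttree U2 u; rewrite cU in hd.
have hd2 := cardsID (leaves T) (nbrs T u).
have lE : (l' = #|nbrs T u :&: leaves T| \/ l' = #|red w Q'|) /\ l' <= #|nbrs T u :&: leaves T|.
  by rewrite /l' geq_minl; split=> //; rewrite /minn; case: ifP; [left | right].
have l'r : l' <= #|red w Q'| by rewrite geq_minr.
have [f [fI fN]] : exists f : U -> V, {in L &, injective f} /\ forall l, l \in L -> f l \in red w Q'.
  by apply: (distinct_representatives (N := fun=> red w Q') (fun=> w)) => l _; rewrite cL.
have [f' [fI' fN']] : exists f : U -> V, {in P &, injective f} /\ forall l, l \in P -> f l \in red w Q.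
  apply: (distinct_representatives (N := fun=> red w Q) (fun=> w)) => l _.
  by move: hub cP cQ cQ' am bm hm hm' hmm c1 c2 hd hd2 lE m9 mn9; clear; lia.
pose g v := if v == u then w else if v \in L then f v else f' v.
have gu : g u = w by rewrite /g eqxx.
have gL l : l \in L -> g l = f l.
  by move=> lL; rewrite /g lL; case: eqP => // E; rewrite -E lL in uL.
have gP l : l \in P -> g l = f' l.
  move=> lP; rewrite /g; case: eqP => [E|_]; first by rewrite -E lP in uP.
  by move: lP; rewrite inE => /andP[/negPf->].
have fQ' l : l \in L -> f l \in Q' /\ G w (f l) by move/fN; rewrite inE => /andP[].
have fQ l : l \in P -> f' l \in Q /\ G w (f' l) by move/fN'; rewrite inE => /andP[].
have wf l : l \in L -> w == f l = false.
  by move=> /fQ'[_]; apply: contraTF => /eqP <-; rewrite Gi.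
apply: (embedding_completion (Q := Q) (Z := Z) (L := u |: L) (P := P) (g := g)) => //.
- rewrite -setI_eq0 -subset0; apply/subsetP=> y /setIP[/setU1P[->|yL]].
    by rewrite (negPf uP).
  by rewrite inE yL.
- move=> y y' /setU1P[->|yL] /setU1P[->|yL'] //; rewrite ?gu ?gL //.
  + by move/eqP; rewrite wf.
  + by move/eqP; rewrite eq_sym wf.
  + exact: fI.
- by move=> y y' yP yP'; rewrite !gP //; apply: fI'.
- by move=> y yP; rewrite gP //; case: (fQ _ yP).
- move=> y /setU1P[->|yL]; first by rewrite gu.
  rewrite gL //; apply/negP=> /KK'; rewrite inE; case: (fQ' _ yL) => -> //.
- move=> y z /setU1P[->|yL] Tyz; rewrite ?gu.
    have [zL|zL] := boolP (z \in L).
      by rewrite gL // !inE zL orbT; case: (fQ' _ zL).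
    have zP : z \in P by rewrite !inE zL.
    by rewrite gP // in_setU zP orbT; case: (fQ _ zP).
  have [Tul ll] := LP _ yL; rewrite Ts in Tul.
  by rewrite (leaf_nbr ll Tyz Tul) gu gL // Gs !inE eqxx; case: (fQ' _ yL).
- rewrite cU cardsU1 uL cL.
  by move: hub cP cQ cQ' cQZ cZ am bm hm hm' hmm c1 c2 hd hd2 lE m9 mn9; clear; lia.
- rewrite cU cardsU1 uL cL.
  by move: hub cP cQ cQ' cQZ cZ am bm hm hm' hmm c1 c2 hd hd2 lE m9 mn9; clear; lia.
Qed.

(** Fewer than [#|Q|] vertices of [Q] are blue to some member of [S], so one is red to all [a] of
    them, against [hub_outside]. For [a = m - 1] the count [a (m - 1) < #|Q|] uses the bound on [n]
    with no slack. *)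
Lemma hub_finish a Q Z (S : {set V}) : core a Q Z -> #|S| = a -> S \subset ~: (Q :|: Z) ->
  (forall w, w \in S -> #|blue w Q| < m) -> False.
Proof.
move=> H cS SK St; have [a0 am cQ cW] := core_bounds H.
have [x xQ xS] : exists2 x, x \in Q & x \notin \bigcup_(w in S) blue w Q.
  apply/subsetPn/negP=> /subset_leq_card.
  have : #|\bigcup_(w in S) blue w Q| <= a * (m - 1).
    rewrite -cS -sum_nat_const (leq_trans (leq_card_bigcup _ _)) //.
    by apply: leq_sum => w /St; move: m9; clear; lia.
  case: H => _ cQZ cZ _; move: cQZ cZ am a0 m9 mn; clear; nia.
have := hub_outside H xQ; rewrite -cS ltnNge; case/negP; apply: subset_leq_card.
apply/subsetP=> w wS; have wK := subsetP SK _ wS.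
rewrite inE wK /=; have : ~~ B x w.
  by apply: contra xS => xw; apply/bigcupP; exists w; rewrite // inE xQ Bs.
rewrite /compl_graph negb_and !negbK => /orP[/eqP E|//].
by rewrite -E !inE xQ in wK.
Qed.

Lemma no_hub : False.
Proof.
have [a [Q [Z H]]] := first_core; have [a0 am cQ cW] := core_bounds H.
have /card_gt0P[x xQ] : 0 < #|Q| by move: cQ am m9 mn9; clear; lia.
have [b [Q' [Z' [H' dK]]]] := second_core H xQ (hub_outside H xQ).
have [|[S [cS SK St]]|[S [cS SK St]]] :=
    @majority _ _ _ _ _ _ (fun w => #|blue w Q| < m) (fun w => #|blue w Q'| < m) H H' dK.
- by move=> w wK wK'; apply: hub_blue H H' dK wK wK'.
- exact: (hub_finish H cS SK St).
- exact: (hub_finish H' cS SK St).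
Qed.
End Hub.

(** * Placing leaves outside a core *)

Section LeafEmbedding.

Definition stem l := odflt l [pick y | T l y].

Lemma stemP l : l \in leaves T -> T l (stem l).
Proof.
move=> ll; rewrite /stem; case: pickP => [//|none].
have /card_gt0P[y] := nbrs_gt0 Ttree U2 l.
by rewrite inE none.
Qed.

(** The [a] places that the core lacks are supplied by leaves outside it, joined in red to their
    stems in [Q]. Leaves are not adjacent, so no stem is itself in [L]. *)
Lemma leaf_embedding a Q Z (L : {set U}) (f g : U -> V) : core a Q Z ->
  L \subset leaves T -> #|L| = a -> {in stem @: L &, injective f} ->
  (forall p, p \in stem @: L -> f p \in Q) -> {in L &, injective g} ->
  (forall l, l \in L -> g l \in red (f (stem l)) (~: (Q :|: Z))) -> False.
Proof.
move=> H LL cL fI fQ gI gR; have [a0 am cQ cW] := core_bounds H; case: H => dQZ cQZ cZ QG.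
apply: noT; pose P := stem @: L.
have cP : #|P| <= a by rewrite -cL leq_imset_card.
have PL p : p \in P -> p \notin L.
  case/imsetP=> l lL ->; apply/negP=> sL.
  have ll := subsetP LL _ lL; have := leaves_nonadjacent Ttree _ ll (subsetP LL _ sL).
  rewrite stemP // => /(_ _)/negP; apply=> //.
  by rewrite cU; move: m9 mn9; clear; lia.
pose h v := if v \in L then g v else f v.
have hL l : l \in L -> h l = g l by rewrite /h => ->.
have hP p : p \in P -> h p = f p by move=> /PL/negPf; rewrite /h => ->.
apply: (embedding_completion (Q := Q) (Z := Z) (L := L) (P := P) (g := h)) => //.
- by apply/pred0P=> p; apply/negP=> /= /andP[pL /PL]; rewrite pL.
- by move=> x y xL yL; rewrite !hL //; apply: gI.
- by move=> x y xL yL; rewrite !hP //; apply: fI.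
- by move=> p pP; rewrite hP // fQ.
- by move=> l lL; rewrite hL //; have := gR _ lL; rewrite !inE => /andP[].
- move=> l y lL Tly; have ll := subsetP LL _ lL.
  rewrite (leaf_nbr ll Tly (stemP ll)); have sP : stem l \in P by apply: imset_f.
  rewrite hL // hP // in_setU sP orbT Gs; split=> //.
  by have := gR _ lL; rewrite inE => /andP[].
- by rewrite cU cL; move: cQZ; clear; lia.
- by rewrite cU cL; move: cP cQ am m9 mn9; clear; lia.
Qed.
End LeafEmbedding.

(** * Trees with [m - 1] well-spread leaves *)

Section Flat.
Variable L0 : {set U}.
Hypotheses (L0l : L0 \subset leaves T) (cL0 : #|L0| = m - 1).
Hypothesis flat : forall p, #|nbrs T p :&: L0| <= m./2.

Definition good a (Q Z : {set V}) := [set x in Q | #|red x (~: (Q :|: Z))| < a].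

Lemma flat_subset a : a < m -> exists2 L : {set U}, L \subset L0 & #|L| = a.
Proof. by move=> am; apply: subset_of_card; rewrite cL0; move: am; clear; lia. Qed.

(** Otherwise [a] vertices of [Q] have [a] red neighbours outside the core: stems of [a] leaves go
    there, and the leaves are attached greedily. *)
Lemma card_good a Q Z : core a Q Z -> #|Q| < #|good a Q Z| + a.
Proof.
move=> H; have [a0 am cQ cW] := core_bounds H.
rewrite ltnNge; apply/negP=> hg.
pose X := Q :\: good a Q Z.
have cX : a <= #|X|.
  have gQ : good a Q Z \subset Q by apply/subsetP=> x; rewrite inE => /andP[].
  by have := cardsID (good a Q Z) Q; rewrite (setIidPr gQ) -/X; move: hg; clear; lia.
have XP x : x \in X -> x \in Q /\ a <= #|red x (~: (Q :|: Z))|.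
  by rewrite !inE => /andP[h xQ]; rewrite xQ /= -leqNgt in h.
have [L LL0 cL] := flat_subset am.
have /card_gt0P[x0 _] : 0 < #|X| by apply: leq_trans cX.
have [f [fI fX]] : exists f : U -> V, {in stem @: L &, injective f} /\ forall p, p \in stem @: L -> f p \in X.
  apply: (distinct_representatives (N := fun=> X) (fun=> x0)) => _ _.
  by rewrite (leq_trans (leq_imset_card _ _)) // cL.
have [g [gI gR]] : exists g : U -> V, {in L &, injective g} /\
    forall l, l \in L -> g l \in red (f (stem l)) (~: (Q :|: Z)).
  apply: (distinct_representatives (fun=> x0)) => l lL.
  by rewrite cL; have [_] := XP _ (fX _ (imset_f stem lL)).
apply: (leaf_embedding H (subset_trans LL0 L0l) cL fI _ gI gR).
by move=> p /fX/XP[].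
Qed.

(** The leaves are placed on [S] first; a stem must then avoid [bad p], the good vertices blue to
    one of its leaves. *)
Lemma flat_finish a Q Z (S : {set V}) : core a Q Z -> #|S| = a -> S \subset ~: (Q :|: Z) ->
  (forall w, w \in S -> 2 * #|blue w (good a Q Z)| + 5 <= 3 * m) -> False.
Proof.
move=> H cS SK St; have [a0 am cQ cW] := core_bounds H; have cg := card_good H.
have [L LL0 cL] := flat_subset am.
have /card_gt0P[s0 _] : 0 < #|S| by rewrite cS.
have [g [gI gS]] : exists g : U -> V, {in L &, injective g} /\ forall l, l \in L -> g l \in S.
  by apply: (distinct_representatives (N := fun=> S) (fun=> s0)) => _ _; rewrite cL cS.
pose bad p := \bigcup_(l in nbrs T p :&: L) blue (g l) (good a Q Z).
have cbad p : 2 * #|bad p| + 5 * #|nbrs T p :&: L| <= 3 * m * #|nbrs T p :&: L|.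
  have : #|bad p| <= \sum_(l in nbrs T p :&: L) #|blue (g l) (good a Q Z)|.
    exact: leq_card_bigcup.
  rewrite -(leq_pmul2l (isT : 0 < 2)) big_distrr /= => hb.
  apply: leq_trans (_ : \sum_(l in nbrs T p :&: L) (2 * #|blue (g l) (good a Q Z)| + 5) <= _).
    by rewrite big_split /= sum_nat_const [_ * 5]mulnC leq_add2r.
  rewrite mulnC -sum_nat_const; apply: leq_sum => l /setIP[_ lL].
  by apply/St/gS.
have [f [fI fN]] : exists f : U -> V, {in stem @: L &, injective f} /\
    forall p, p \in stem @: L -> f p \in good a Q Z :\: bad p.
  apply: (distinct_representatives (fun=> s0)) => p _.
  apply: leq_trans (leq_imset_card _ _) _; rewrite cL.
  have badg : bad p \subset good a Q Z.
    by apply/bigcupsP=> l _; apply/subsetP=> x; rewrite inE => /andP[].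
  have := cardsID (bad p) (good a Q Z); rewrite (setIidPr badg).
  have : #|nbrs T p :&: L| <= m./2 by apply: leq_trans (flat p); rewrite subset_leq_card // setIS.
  have := cbad p; case: H => _ cQZ cZ _.
  have : 2 * m./2 <= m by clear; lia.
  (* A stem has at most [m / 2] leaves, so [#|bad p| <= m (3 m - 5) / 4], while
     [#|good a Q Z| - a >= m^2 - 4 m + 5]. This comes down to [m^2 - 11 m + 20 >= 0], which holds
     from [m = 9] on. *)
  by move: cQZ cZ cg am a0 m9 mn; clear; nia.
have goodQ x : x \in good a Q Z -> x \in Q by rewrite inE => /andP[].
apply: (leaf_embedding H (subset_trans LL0 L0l) cL fI _ gI).
  by move=> p /fN; rewrite inE => /andP[_ /goodQ].
move=> l lL; have gK := subsetP SK _ (gS _ lL); rewrite inE gK /=.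
have := fN _ (imset_f stem lL); rewrite inE => /andP[fb fg].
have : ~~ B (f (stem l)) (g l).
  apply: contra fb => bl; apply/bigcupP; exists l.
    by rewrite in_setI lL andbT inE Ts stemP // (subsetP L0l) // (subsetP LL0).
  by rewrite inE fg Bs.
rewrite /compl_graph negb_and !negbK => /orP[/eqP E|//].
by rewrite -E in_setC in_setU (goodQ _ fg) in gK.
Qed.

(** If both blue degrees are at least [m], their sum is at most [a + b + m - 3 <= 3 m - 5], and the
    smaller one is at most half of it. *)
Lemma flat_blue a b Q Z Q' Z' w : core a Q Z -> core b Q' Z' ->
  [disjoint Q :|: Z & Q' :|: Z'] ->
  (2 * #|blue w (good a Q Z)| + 5 <= 3 * m) || (2 * #|blue w (good b Q' Z')| + 5 <= 3 * m).
Proof.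
move=> H H' dK; have [a0 am _ _] := core_bounds H; have [b0 bm _ _] := core_bounds H'.
have KK' y : y \in Q -> y \in Q' -> False.
  by move=> yQ yQ'; have /pred0P/(_ y) := dK; rewrite /= !inE yQ yQ'.
have KZ y : y \in Q -> y \in Q' :|: Z' -> False.
  by move=> yQ yK; have /pred0P/(_ y) := dK; rewrite /= yK inE yQ.
have KZ' y : y \in Q' -> y \in Q :|: Z -> False.
  by move=> yQ yK; have /pred0P/(_ y) := dK; rewrite /= yK inE yQ.
have goodQ c X Y x : x \in good c X Y -> x \in X by rewrite inE => /andP[].
have [hm|hm] := ltnP #|blue w (good a Q Z)| m.
  by apply/orP; left; move: hm m9; clear; lia.
have [hm'|hm'] := ltnP #|blue w (good b Q' Z')| m.
  by apply/orP; right; move: hm' m9; clear; lia.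
suff : #|blue w (good a Q Z)| + #|blue w (good b Q' Z')| + 3 <= a + b + m.
  by move: am bm; clear; lia.
apply: blue_both_sides => //.
- rewrite -setI_eq0 -subset0; apply/subsetP=> y /setIP[/goodQ yQ /goodQ yQ'].
  by case: (KK' y).
- move=> x xg; have := xg; rewrite [x \in _]inE => /andP[xQ].
  apply: leq_ltn_trans; apply: subset_leq_card; apply/subsetP=> y.
  rewrite inE => /andP[/goodQ yQ' Gxy]; rewrite inE Gxy andbT in_setC.
  by apply/negP=> /(KZ' _ yQ').
- move=> x xg; have := xg; rewrite [x \in _]inE => /andP[xQ].
  apply: leq_ltn_trans; apply: subset_leq_card; apply/subsetP=> y.
  rewrite inE => /andP[/goodQ yQ' Gxy]; rewrite inE Gxy andbT in_setC.
  by apply/negP=> /(KZ _ yQ').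
Qed.

Lemma no_flat_leaves : False.
Proof.
have [a [Q [Z H]]] := first_core; have [a0 am cQ cW] := core_bounds H.
have /card_gt0P[x] : 0 < #|good a Q Z|.
  by have := card_good H; move: cQ am m9 mn9; clear; lia.
rewrite inE => /andP[xQ rx].
have [b [Q' [Z' [H' dK]]]] := second_core H xQ rx.
have [|[S [cS SK St]]|[S [cS SK St]]] :=
    @majority _ _ _ _ _ _ (fun w => 2 * #|blue w (good a Q Z)| + 5 <= 3 * m)
      (fun w => 2 * #|blue w (good b Q' Z')| + 5 <= 3 * m) H H' dK.
- by move=> w _ _; apply: flat_blue H H' dK.
- exact: (flat_finish H cS SK St).
- exact: (flat_finish H' cS SK St).
Qed.
End Flat.

(** * Trees with few leaves *)

Section Thin.
Hypothesis nohub : forall u, #|nbrs T u :&: leaves T| < m - 1.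
Hypothesis noflat : ~ exists L : {set U},
  [/\ L \subset leaves T, #|L| = m - 1 & forall p, #|nbrs T p :&: L| <= m./2].

Lemma thin_packing a : a < m -> exists D : {set U},
  [/\ #|D| = a, {in D, forall q, #|nbrs T q| <= 2} &
    {in D &, forall q q', q != q' -> [disjoint q |: nbrs T q & q' |: nbrs T q']}].
Proof.
move=> am; apply: (closed_nbrs_packing Ttree U2).
have : #|leaves T| < 2 * (m - 1) - 1.
  rewrite ltnNge; apply/negP=> h; apply: noflat; apply: flat_leaves h _ => //.
  - by move: m9; clear; lia.
  - by move: m9; clear; lia.
by rewrite cU; move: am m9 mn; clear; nia.
Qed.

(** [S] receives [a] packed vertices of degree at most [2]. They have at most [2 a] neighbours in
    all, which are placed greedily in [Q]. *)
Lemma thin_finish a Q Z (S : {set V}) : core a Q Z -> #|S| = a -> S \subset ~: (Q :|: Z) ->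
  (forall w, w \in S -> 2 * a <= #|red w Q|) -> False.
Proof.
move=> H cS SK St; have [a0 am cQ cW] := core_bounds H; case: H => dQZ cQZ cZ QG.
have [D [cD D2 Dd]] := thin_packing am.
have /card_gt0P[s0 _] : 0 < #|S| by rewrite cS.
have [g [gI gS]] : exists g : U -> V, {in D &, injective g} /\ forall l, l \in D -> g l \in S.
  by apply: (distinct_representatives (N := fun=> S) (fun=> s0)) => _ _; rewrite cD cS.
pose P := \bigcup_(q in D) nbrs T q.
(* The packed vertex next to [p], unique because the closed neighbourhoods are disjoint. *)
pose ctr p := odflt p [pick q in D | T q p].
have Duniq p q q' : q \in D -> q' \in D -> p \in q |: nbrs T q -> p \in q' |: nbrs T q' -> q = q'.
  move=> qD q'D pq pq'; apply/eqP/negPn/negP=> nqq; have /pred0P/(_ p) := Dd _ _ qD q'D nqq.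
  by rewrite /= pq pq'.
have ctrE q p : q \in D -> T q p -> ctr p = q.
  move=> qD Tqp; rewrite /ctr; case: pickP => [q' /andP[q'D Tq'p]|/(_ q)]; last by rewrite qD Tqp.
  by apply: (Duniq p) => //; rewrite !inE ?Tqp ?Tq'p orbT.
have PP p : p \in P -> exists2 q, q \in D & T q p.
  by case/bigcupP=> q qD; rewrite inE => Tqp; exists q.
have cP : #|P| <= 2 * a.
  rewrite (leq_trans (leq_card_bigcup _ _)) //.
  by rewrite -cD mulnC -sum_nat_const; apply: leq_sum => q /D2.
have [f [fI fN]] : exists f : U -> V, {in P &, injective f} /\
    forall p, p \in P -> f p \in red (g (ctr p)) Q.
  apply: (distinct_representatives (fun=> s0)) => p /PP[q qD Tqp].
  by rewrite (ctrE _ _ qD Tqp) (leq_trans cP) // St // gS.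
have PD p : p \in P -> p \notin D.
  move=> /PP[q qD Tqp]; apply/negP=> pD.
  have E : q = p by apply: (Duniq p) => //; rewrite !inE ?Tqp ?eqxx ?orbT.
  by rewrite E Ti in Tqp.
pose h v := if v \in D then g v else f v.
have hD l : l \in D -> h l = g l by rewrite /h => ->.
have hP p : p \in P -> h p = f p by move=> /PD/negPf; rewrite /h => ->.
apply: noT; apply: (embedding_completion (Q := Q) (Z := Z) (L := D) (P := P) (g := h)) => //.
- by apply/pred0P=> p; apply/negP=> /= /andP[pL /PD]; rewrite pL.
- by move=> x y xL yL; rewrite !hD //; apply: gI.
- by move=> x y xL yL; rewrite !hP //; apply: fI.
- by move=> p pP; rewrite hP //; have := fN _ pP; rewrite inE => /andP[].
- by move=> l lL; rewrite hD // -in_setC (subsetP SK) // gS.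
- move=> q p qD Tqp; have pP : p \in P by apply/bigcupP; exists q; rewrite ?inE.
  rewrite hD // hP // in_setU pP orbT; split=> //.
  by have := fN _ pP; rewrite (ctrE _ _ qD Tqp) inE => /andP[].
- by rewrite cU cD; move: cQZ; clear; lia.
- by rewrite cU cD; move: cP cQ am m9 mn9; clear; lia.
Qed.

Lemma thin_edge : exists (Y : {set U}) z z', [/\ z \in Y, m - 1 <= #|Y|, 2 * #|Y| <= n, T z z' &
  z' \notin Y /\ forall x y, x \in Y -> y \notin Y -> T x y -> x = z /\ y = z'].
Proof.
have [||Y [z [z' [zY cY cY' Tzz [z'Y cut]]]]] := balanced_edge Ttree U2 _ _ nohub noflat.
- by move: m9; clear; lia.
- by rewrite cU; move: m9 mn; clear; nia.
have cC := cardsC Y; rewrite cU in cC.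
have [small|big] := leqP (2 * #|Y|) n; first by exists Y, z, z'.
exists (~: Y), z', z; rewrite !inE negbK Ts; split=> //.
  by move: cC big; clear; lia.
split=> // x y; rewrite !inE negbK => xY yY Txy; rewrite Ts in Txy.
by have [-> ->] := cut _ _ yY xY Txy.
Qed.

(** A red edge [xw] could carry the balanced edge: the smaller side [Y] embeds greedily in [W] from
    [z] at [w], and the other side goes to the core with [z'] at [x]. Since [#|Y| >= m - 1 >= a],
    the core is large enough. *)
Lemma thin_separated a Q Z (W : {set V}) : core a Q Z -> W \subset ~: (Q :|: Z) ->
  (forall w, w \in W -> n + 5 <= #|red w W| + 4 * m) ->
  forall x w, x \in Q -> w \in W -> ~~ G x w.
Proof.
move=> H WK hW x w xQ wW; apply/negP=> Gxw.
have [a0 am cQ cW] := core_bounds H; case: H => dQZ cQZ cZ QG.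
have [Y [z [z' [zY cY cY2 Tzz [z'Y cut]]]]] := thin_edge.
have [| |g [gz gI gW gT]] := tree_part_embedding Ttree (W := W) Gs Gi zY _ wW.
- move=> p q pY pz Tpq; apply/negPn/negP=> qY.
  by have [E _] := cut _ _ pY qY Tpq; rewrite E eqxx in pz.
- by move=> v /hW; rewrite -/(red v W); move: cY2 m9 mn9; clear; lia.
pose h v := if v \in Y then g v else x.
have hY l : l \in Y -> h l = g l by rewrite /h => ->.
have hz' : h z' = x by rewrite /h (negPf z'Y).
apply: noT; apply: (embedding_completion (Q := Q) (Z := Z) (L := Y) (P := [set z']) (g := h)) => //.
- by rewrite disjoint_sym disjoints1.
- by move=> p q pY qY; rewrite !hY //; apply: gI.
- by move=> p q /set1P-> /set1P->.
- by move=> p /set1P->; rewrite hz'.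
- by move=> l lY; rewrite hY // -in_setC (subsetP WK) // gW.
- move=> p q pY Tpq; have [qY|qY] := boolP (q \in Y).
    by rewrite in_setU qY !hY // gT.
  have [-> ->] := cut _ _ pY qY Tpq.
  by rewrite hz' hY // gz Gs !inE eqxx orbT.
- by rewrite cU; move: cQZ cY am; clear; lia.
- by rewrite cU cards1; move: cQ cY cY2 am m9 mn9; clear; lia.
Qed.

Lemma no_thin_tree : False.
Proof.
have [a [Q [Z H]]] := first_core; have [a0 am cQ cW] := core_bounds H.
have [dQZ cQZ cZ QG] := H.
pose W1 := [set w in ~: (Q :|: Z) | 2 * a <= #|red w Q|].
have cW1 : #|W1| < a.
  rewrite ltnNge; apply/negP=> h; have [S SW cS] := subset_of_card h.
  apply: (thin_finish H cS); first by apply/subsetP=> w /(subsetP SW); rewrite inE => /andP[].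
  by move=> w /(subsetP SW); rewrite inE => /andP[].
pose W2 := ~: (Q :|: Z) :\: W1.
have W1K : W1 \subset ~: (Q :|: Z) by apply/subsetP=> w; rewrite inE => /andP[].
have cW2 : n <= #|W2|.
  by have := cardsID W1 (~: (Q :|: Z)); rewrite (setIidPr W1K) -/W2; move: cW cW1; clear; lia.
(* From the [n - m] red neighbours of [red_min_degree], at most [2 a - 1] in [Q], [#|Z|] in [Z] and
   [a - 1] in [W1] are lost, and [3 a + #|Z| <= 3 (m - 1)]. *)
have deg2 w : w \in W2 -> n + 5 <= #|red w W2| + 4 * m.
  move=> wW2; have rQ : #|red w Q| < 2 * a.
    by move: wW2; rewrite inE => /andP[h wK]; move: h; rewrite inE wK /= -ltnNge.
  have sub : red w setT \subset red w W2 :|: (red w Q :|: (Z :|: W1)).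
    apply/subsetP=> y; rewrite /W2; rewrite !in_setU inE in_setT /= => Gwy.
    rewrite ![y \in red _ _]inE Gwy !andbT in_setD in_setC in_setU.
    by case: (y \in Q) => //=; case: (y \in Z); rewrite ?orbT //=; case: (y \in W1).
  have := subset_leq_card sub; have := red_min_degree w.
  have [c1 _] := leq_card_setU (red w W2) (red w Q :|: (Z :|: W1)).
  have [c2 _] := leq_card_setU (red w Q) (Z :|: W1); have [c3 _] := leq_card_setU Z W1.
  by move: c1 c2 c3 rQ cW1 cZ am m9; clear; lia.
have sep := thin_separated H (subsetDl _ _) deg2.
have /card_gt0P[x xQ] : 0 < #|Q| by move: cQ am m9 mn9; clear; lia.
have W2K w : w \in W2 -> w \notin Q :|: Z by rewrite inE in_setC => /andP[].
have [y yW2|b [Q' [Z' [H' sub]]]] := @core_exists x W2 _ cW2.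
  rewrite /compl_graph sep // andbT; apply: contraTneq xQ => ->.
  by have := W2K _ yW2; rewrite inE negb_or => /andP[].
have dK : [disjoint Q :|: Z & Q' :|: Z'].
  rewrite -setI_eq0 -subset0; apply/subsetP=> y /setIP[yK /(subsetP sub)/W2K].
  by rewrite yK.
have Q'W2 y : y \in Q' -> y \in W2 by move=> yQ; apply: (subsetP sub); rewrite inE yQ.
have dQ : [disjoint Q & Q'].
  rewrite -setI_eq0 -subset0; apply/subsetP=> y /setIP[yQ /Q'W2/W2K].
  by rewrite inE yQ.
have [b0 bm cQ' cW'] := core_bounds H'.
(* No red edge joins [Q] and [Q'], so [blue_both_sides] applies with both parameters equal to
   [1]. *)
have types w : (#|blue w Q| < m) || (#|blue w Q'| < m).
  apply/negPn/negP; rewrite negb_or -!leqNgt => /andP[hm hm'].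
  suff : #|blue w Q| + #|blue w Q'| + 3 <= 1 + 1 + m by move: hm hm'; clear; lia.
  apply: blue_both_sides => // y yQ; rewrite ltnS leqn0 cards_eq0 -subset0;
    apply/subsetP=> v; rewrite inE => /andP[vQ].
    by rewrite (negPf (sep _ _ yQ (Q'W2 _ vQ))).
  by rewrite Gs (negPf (sep _ _ vQ (Q'W2 _ yQ))).
have many c X Y w : core c X Y -> w \notin X :|: Y -> #|blue w X| < m -> 2 * c <= #|red w X|.
  move=> /core_bounds[_ cm cX _] wX; have : w \notin X by apply: contra wX; rewrite inE => ->.
  by move/card_red_blue; move: cX cm m9 mn9; clear; lia.
have [//|[S [cS SK St]]|[S [cS SK St]]] :=
    @majority _ _ _ _ _ _ (fun w => #|blue w Q| < m) (fun w => #|blue w Q'| < m) H H' dK.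
- apply: (thin_finish H cS SK) => w wS; apply: many H _ (St _ wS).
  by rewrite -in_setC (subsetP SK).
- apply: (thin_finish H' cS SK) => w wS; apply: many H' _ (St _ wS).
  by rewrite -in_setC (subsetP SK).
Qed.
End Thin.

Lemma tree_or_fan_contradiction : False.
Proof.
have [/existsP[u hu]|] := boolP [exists u, m - 1 <= #|nbrs T u :&: leaves T|].
  exact: no_hub hu.
rewrite negb_exists => /forallP nohub.
have [/existsP[L /and3P[LL /eqP cL /forallP flat]]|noflat] :=
    boolP [exists L : {set U}, [&& L \subset leaves T, #|L| == m - 1 & [forall p, #|nbrs T p :&: L| <= m./2]]].
  exact: no_flat_leaves LL cL flat.
apply: no_thin_tree => [u|[L [LL cL flat]]]; first by rewrite ltnNge nohub.
by case/existsP: noflat; exists L; rewrite LL cL eqxx; apply/forallP.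
Qed.
End UpperBound.

(** * The Ramsey number *)

Lemma two_cliques_lower_bound (n m M : nat) (T : rel 'I_n) :
  connected_graph T -> 0 < n -> 0 < m -> M < 2 * n - 1 -> ~ ramsey_prop T (fan m) M.
Proof.
move=> Tc n0 m0 Mn H.
pose G : rel 'I_M := fun x y => (x != y) && ((x < n - 1) == (y < n - 1)).
have [|[f [fI fT]]|[f [fI fT]]] := H G.
- split=> [x y|x]; last by rewrite /G eqxx.
  by rewrite /G eq_sym [X in _ && X]eq_sym.
- pose x0 := Ordinal n0.
  have same x : (f x < n - 1) = (f x0 < n - 1).
    have cl : closed T [pred y | (f y < n - 1) == (f x0 < n - 1)].
      by move=> a b /fT /andP[_ /eqP E]; rewrite !inE E.
    by have := closed_connect cl (Tc x0 x); rewrite !inE eqxx => /esym/eqP.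
  (* Connectedness keeps the copy of [T] in one clique; numbering that clique would put [n] vertices
     into [n - 1] places. *)
  pose h x : nat := if f x < n - 1 then (f x : nat) else f x - (n - 1).
  have hI : injective h.
    move=> x y; rewrite /h !same => E; apply/fI/val_inj => /=; move: E.
    by have := same x; have := same y; clear; case: ifP; lia.
  have hn x : h x \in iota 0 (n - 1).
    by rewrite mem_iota /h; have := ltn_ord (f x); move: Mn; clear; case: ifP; lia.
  have := uniq_leq_size (s1 := [seq h x | x <- enum 'I_n]) (s2 := iota 0 (n - 1)).
  rewrite map_inj_uniq // enum_uniq size_map size_enum_ord size_iota => /(_ isT).
  have sub : {subset [seq h x | x <- enum 'I_n] <= iota 0 (n - 1)} by move=> _ /mapP[x _ ->].
  by move/(_ sub); move: (n0); clear; lia.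
have lt0 : 0 < 2 * m + 1 by rewrite addn1.
have lt1 : 1 < 2 * m + 1 by move: m0; clear; lia.
have lt2 : 2 < 2 * m + 1 by move: m0; clear; lia.
(* The blue graph is bipartite, so it cannot contain the triangle [0], [1], [2] of the fan. *)
have diff x y : fan m x y -> (f x < n - 1) != (f y < n - 1).
  by move=> /fT; rewrite /compl_graph /G => /andP[->].
have := diff (Ordinal lt0) (Ordinal lt1) isT; have := diff (Ordinal lt0) (Ordinal lt2) isT.
have := diff (Ordinal lt1) (Ordinal lt2) isT.
by do 3!case: (_ < _).
Qed.

Theorem theorem4 (m n : nat) (T : rel 'I_n) :
  9 <= m -> m ^ 2 - m + 1 <= n -> is_tree T ->
  is_ramsey_number T (fan m) (2 * n - 1).
Proof.
move=> m9 mn Tt; have mn' : m * m + 1 <= n + m by move: mn; rewrite -mulnn; clear; lia.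
have n0 : 0 < n by move: mn; clear; lia.
split; first by move: n0; clear; lia.
split; last first.
  by move=> M _; apply: two_cliques_lower_bound (proj1 (proj2 Tt)) n0 (leq_trans _ m9).
move=> G Gs.
have [?|noT] := contains_subgraph_dec G T; first by left.
have [?|noF] := contains_subgraph_dec (compl_graph G) (fan m); first by right.
by case: (tree_or_fan_contradiction Tt Gs (card_ord n) (card_ord _) m9 mn' noT noF).
Qed.
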